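(* Let $f$ and $g$ be offspring generating functions with the same mean $f'(1)=g'(1)=m>1$, and suppose that $f''(1)<\infty$ and $g''(1)=\infty$. Let the tree-indexed variables $X(v)$ be uniformly distributed on $[0,1]$. Then there is a sequence of positive numbers $(p_n)_{n\ge 1}$ with $p_n\le 1$ for all $n$ such that (i) $\sum_{n=1}^\infty \prod_{k=1}^n (m\cdot p_k)^{-1}<\infty$, and (ii) the branching process in a varying environment with offspring generating functions $g_n(z)=g(1-p_n+p_nz)$ dies out almost surely; and the set $$B=\{(x_1,x_2,\ldots)\in\mathbb{R}^\infty : x_n\le p_n \text{ for all } n\ge 1\}$$ defined from this sequence is polar for almost every Galton-Watson tree with offspring generating function $g$, and is nonpolar for almost every Galton-Watson tree with offspring generating function $f$.
   Context: An offspring generating function is a power series $f(z)=\sum_{k\ge 0} q_k z^k$ with $q_k\ge 0$ and $\sum_k q_k=1$; $f'(1)=\sum_k kq_k$ and $f''(1)=\sum_k k(k-1)q_k\in[0,\infty]$. A branching process in a varying environment with offspring generating functions $g_n(z)=\sum_k q_{n,k}z^k$, $n\ge 1$, is the random rooted family tree in which the root has $k$ children with probability $q_{1,k}$ and, independently, each individual of generation $n$ has $k$ children with probability $q_{n+1,k}$; it dies out if some generation is empty. A Galton-Watson tree with offspring generating function $f$ is the case in which all the offspring generating functions equal $f$. For a rooted tree $\Gamma$, a process indexed by $\Gamma$ is a set of i.i.d. real random variables $\{X(v)\}$ indexed by the vertices $v$ of $\Gamma$. Let $B\subseteq\mathbb{R}^\infty$ (sequences of reals) be closed in the product topology. The set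 $B$ is polar for $\Gamma$ (and for the common distribution of the $X(v)$) if and only if the probability is zero that there exists an infinite self-avoiding path $v_0,v_1,v_2,\ldots$ in $\Gamma$ starting from the root $v_0$ and satisfying $(X(v_1),X(v_2),\ldots)\in B$; otherwise $B$ is nonpolar for $\Gamma$. Here $\Gamma$ is fixed and the probability is over the variables $X(v)$; ''for almost every Galton-Watson tree'' means for almost every realization $\Gamma$ of the random tree.
   Formalization: Nonpolarity for f is claimed for almost every Galton-Watson tree that does not die out: if f(0)>0 the tree is finite with positive probability, and then every set is polar for it, so the unconditioned claim fails. *)

(* Defs.v *)
From HB Require Import structures.
From mathcomp Require Import all_boot all_order all_algebra.
From mathcomp Require Import all_classical all_reals all_analysis.

Set Implicit Arguments.
Unset Strict Implicit.
Unset Printing Implicit Defensive.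

Import Order.TTheory GRing.Theory Num.Theory.
Import numFieldNormedType.Exports.

Local Open Scope classical_set_scope.
Local Open Scope ring_scope.

(* A power series sum_k q_k z^k is represented by its coefficients q. *)

Definition offspring_gf (R : realType) (q : nat -> R) : Prop :=
  (forall k, 0 <= q k) /\ (\sum_(0 <= k <oo) (q k)%:E = 1)%E.

Definition gf_eval (R : realType) (q : nat -> R) (z : R) : R :=
  limn (series (fun k => q k * z ^+ k)).

(* First and second derivatives at 1, possibly +oo. *)
Definition gf_deriv1 (R : realType) (q : nat -> R) : \bar R :=
  (\sum_(0 <= k <oo) (k%:R * q k)%:E)%E.

Definition gf_deriv2 (R : realType) (q : nat -> R) : \bar R :=
  (\sum_(0 <= k <oo) ((k * k.-1)%N%:R * q k)%:E)%E.

(* Mutual independence: the product rule over every finite subfamily. *)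
Definition independent_family (R : realType) (d d' : measure_display)
    (T : measurableType d) (T' : measurableType d') (P : probability T R)
    (I : eqType) (X : I -> {RV P >-> T'}) : Prop :=
  forall (s : seq I) (A : I -> set T'), uniq s ->
    (forall i, measurable (A i)) ->
    (P (\bigcap_(i in [set` s]) (X i @^-1` A i)) =
     \prod_(i <- s) P (X i @^-1` A i))%E.

(* Rooted family trees in Ulam-Harris coding: a vertex is the list of birth
   ranks along its line of descent, the root is [::], the children of u are the
   rcons u i, and the generation of u is its size.  In [family_tree c] the
   vertex u has c u children. *)
Inductive family_tree (c : seq nat -> nat) : set (seq nat) :=
| family_tree_root : family_tree c [::]
| family_tree_child u i :
    family_tree c u -> (i < c u)%N -> family_tree c (rcons u i).

Definition dies_out (G : set (seq nat)) : Prop :=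
  exists n, forall u, G u -> size u <> n.

Definition adjacent (u v : seq nat) : Prop :=
  (exists i, v = rcons u i) \/ (exists i, u = rcons v i).

Definition infinite_path (G : set (seq nat)) (v : nat -> seq nat) : Prop :=
  [/\ v 0%N = [::], forall n, G (v n), forall n, adjacent (v n) (v n.+1)
    & injective v].

(* [N] gives the numbers of children of all potential individuals, so that
   [family_tree (fun u => N u w)] is the random family tree; [q n], for n >= 1,
   is the offspring law of the individuals of generation n - 1. *)
Definition branching_process (R : realType) (d : measure_display)
    (T : measurableType d) (P : probability T R)
    (q : nat -> nat -> R) (N : seq nat -> {RV P >-> nat}) : Prop :=
  independent_family N /\
  forall u k, P (N u @^-1` [set k]) = (q (size u).+1 k)%:E.

Definition galton_watson (R : realType) (d : measure_display)
    (T : measurableType d) (P : probability T R)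
    (q : nat -> R) (N : seq nat -> {RV P >-> nat}) : Prop :=
  branching_process (fun=> q) N.

(* One variable is attached to every potential vertex; the process indexed by
   a tree G is the restriction of X to G. *)
Definition iid_uniform01 (R : realType) (d : measure_display)
    (T : measurableType d) (P : probability T R)
    (X : seq nat -> {RV P >-> R}) : Prop :=
  independent_family X /\
  forall u (A : set R), measurable A ->
    distribution P (X u) A = uniform_prob (@ltr01 R) A.

(* The sequence (x_1, x_2, ...) is coded as n |-> x_(n+1).  The event is
   measurable when B is closed and every vertex of G has finitely many
   children, and it is then negligible iff its probability is 0. *)
Definition polar (R : realType) (d : measure_display)
    (T : measurableType d) (P : probability T R)
    (X : seq nat -> {RV P >-> R}) (G : set (seq nat)) (B : set (nat -> R)) :
    Prop :=
  P.-negligible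
    [set w | exists v, infinite_path G v /\ B (fun n => X (v n.+1) w)].

Definition nonpolar (R : realType) (d : measure_display)
    (T : measurableType d) (P : probability T R)
    (X : seq nat -> {RV P >-> R}) (G : set (seq nat)) (B : set (nat -> R)) :
    Prop :=
  ~ polar X G B.

(* Main.v *)
Require Import Defs.
From HB Require Import structures.
From mathcomp Require Import all_boot all_order all_algebra.
From mathcomp Require Import all_classical all_reals all_analysis.
From mathcomp Require Import measurable_realfun ring lra.

Set Implicit Arguments.
Unset Strict Implicit.
Unset Printing Implicit Defensive.

Import Order.TTheory GRing.Theory Num.Theory.
Import numFieldNormedType.Exports.

Local Open Scope classical_set_scope.
Local Open Scope ring_scope.

(** Keep each vertex [v] at generation [k >= 1] with probability [p k]; the events
[X v <= p k] do this for a process of independent uniform variables.  With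
[phi x = 1 - g (1 - x)], the probability that the thinned tree with offspring
generating function [g] reaches depth [n] is
[phi (p 1 * phi (p 2 * ... phi (p n)))], the number [surv] of the word
[p 1, ..., p n] ([reach_prob], [joint_reach_prob]).  Everything rests on how
[phi] departs from its tangent [m * x] at [0].

If the second derivative at 1 is finite, then [1 / phi x <= 1 / (m * x) + c]
([gf_surv_inv]); iterating this along a word bounds [1 / surv] by a constant
times one plus the sum in (i) ([surv_inv]), so (i) forces survival with
positive probability.  If it is infinite, then
[phi x <= m * x - K * x ^ 2] near 0 for every [K] ([gf_surv_gap]).  A long stretch at the slightly supercritical level
[(1 + eta) / m] then brings [surv] far below [eta], although its contribution
to the sum in (i) is only about [1 / eta].  Putting in front of it [l]
unthinned generations, with [eta = m ^ -l], divides that contribution by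
[m ^ l = 1 / eta] and multiplies [surv] by at most [1 / eta]: the result is a
finite word whose sum is bounded independently of how small its [surv] is
([thinning_word]).  The sequence [p] concatenates such words, each chosen after
its predecessors and at least doubling the mean size of the thinned population,
so that the sums add up geometrically while [surv] tends to 0
([exists_thinning]).  This gives (i), (ii) and, by Fubini, polarity for [g].

For [f], the bound on sums holds from the start of each word on, hence the
joint survival probability from these generations is at least some [s0 > 0].
Call a vertex null when almost surely no kept infinite path starts from it.
The children of a null vertex are null ([null_set_child]) and the subtrees are
independent, so if nullity at generation [n] has probability at most [1 - s0],
then the root is null with probability at most [1 - phi^n s0]
([null_set_iter]), [phi] being now taken for [f].  Generation [n]
is empty with probability [1 - phi^n 1], and this implies nullity of the root.
The two iterates come together ([iter_surv_close]), so nullity of the root is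
almost surely the same event as extinction, and by Koenig's lemma a tree whose
root is not null is a tree for which the set is nonpolar. *)

(** * The survival function of an offspring law *)

Section OffspringLaw.
Context {R : realType}.
Implicit Types (q : nat -> R) (x z : R).

Lemma expr_itv01 x k : 0 <= x <= 1 -> 0 <= x ^+ k <= 1.
Proof. by case/andP => x0 x1; rewrite exprn_ge0 //= exprn_ile1. Qed.

(** Probability that an individual has at least one kept child when each child is
kept independently with probability [x]. *)
Definition gf_surv q x : R := 1 - gf_eval q (1 - x).

Lemma gf_evalE q z : offspring_gf q -> 0 <= z <= 1 ->
  ((gf_eval q z)%:E = \sum_(0 <= k <oo) (q k * z ^+ k)%:E)%E.
Proof.
move=> [q0 q1] /andP[z0 z1]; rewrite /gf_eval.
have qz0 k : 0 <= q k * z ^+ k by rewrite mulr_ge0 ?exprn_ge0.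
rewrite -EFin_lim; last first.
  apply: nnseries_is_cvg => //.
  apply: le_lt_trans (ltry (1 : R)); rewrite -q1.
  apply: lee_nneseries => k _; rewrite lee_fin // ler_piMr // exprn_ile1 //.
by apply/congr_lim/funext => n /=; rewrite /series /= -sumEFin.
Qed.

Lemma gf_eval_ge0 q z : offspring_gf q -> 0 <= z <= 1 -> 0 <= gf_eval q z.
Proof.
move=> hq /andP[z0 z1]; rewrite -lee_fin gf_evalE ?z0 //.
by apply: nneseries_ge0 => k _ _; rewrite lee_fin mulr_ge0 ?exprn_ge0 // hq.1.
Qed.

Lemma gf_survE q x : offspring_gf q -> 0 <= x <= 1 ->
  ((gf_surv q x)%:E = \sum_(0 <= k <oo) (q k * (1 - (1 - x) ^+ k))%:E)%E.
Proof.
move=> hq x01; have [q0 q1] := hq.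
have z01 : 0 <= 1 - x <= 1 by lra.
have ez k : 0 <= (1 - x) ^+ k <= 1.
  by case/andP: z01 => z0 z1; rewrite exprn_ge0 //= exprn_ile1.
have : ((1 : R)%:E = (gf_eval q (1 - x))%:E +
    \sum_(0 <= k <oo) (q k * (1 - (1 - x) ^+ k))%:E)%E.
  rewrite gf_evalE // -nneseriesD; last 2 first.
  - by move=> i _ _; rewrite lee_fin mulr_ge0 //; case/andP: (ez i).
  - by move=> i _ _; rewrite lee_fin mulr_ge0 // subr_ge0; case/andP: (ez i).
  rewrite -q1; apply: eq_eseriesr => k _; rewrite -EFinD; congr EFin; ring.
rewrite /gf_surv EFinB => ->.
by rewrite addeAC subee // add0e.
Qed.

Lemma gf_surv_le1 q x : offspring_gf q -> 0 <= x <= 1 -> gf_surv q x <= 1.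
Proof.
move=> hq x01; rewrite /gf_surv lerBlDr lerDl gf_eval_ge0 //; lra.
Qed.

Lemma gf_surv_ge0 q x : offspring_gf q -> 0 <= x <= 1 -> 0 <= gf_surv q x.
Proof.
move=> hq x01; rewrite -lee_fin gf_survE //.
apply: nneseries_ge0 => k _ _; rewrite lee_fin mulr_ge0 ?hq.1 //.
have : 0 <= 1 - x <= 1 by lra.
by move=> /(expr_itv01 k); lra.
Qed.

Lemma gf_surv_itv q x : offspring_gf q -> 0 <= x <= 1 ->
  0 <= gf_surv q x <= 1.
Proof. by move=> hq x01; rewrite gf_surv_ge0 ?gf_surv_le1. Qed.

Lemma gf_surv_mono q x y : offspring_gf q -> 0 <= x -> x <= y -> y <= 1 ->
  gf_surv q x <= gf_surv q y.
Proof.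
move=> hq x0 xy y1; rewrite -lee_fin !gf_survE //; [|lra..].
apply: lee_nneseries => k _; rewrite lee_fin.
  rewrite mulr_ge0 ?hq.1 //.
  have : 0 <= 1 - x <= 1 by lra.
  by move=> /(expr_itv01 k); lra.
rewrite ler_wpM2l ?hq.1 // lerD2l lerN2 lerXn2r ?nnegrE; lra.
Qed.

Lemma one_sub_expr_le x k : 0 <= x <= 1 -> 1 - (1 - x) ^+ k <= k%:R * x.
Proof.
move=> x01; elim: k => [|k IH]; first by rewrite expr0; lra.
have := @expr_itv01 (1 - x) k; rewrite exprS -natr1 => H.
have {}H : 0 <= (1 - x) ^+ k <= 1 by apply: H; lra.
by nra.
Qed.

(** The bound [(1 + k * x)^-1] of [(1 - x) ^+ k] stays useful when [k * x] is large,
where the second-order expansion fails. *)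
Lemma expr_one_sub_mul x k : 0 <= x <= 1 -> (1 - x) ^+ k * (1 + k%:R * x) <= 1.
Proof.
move=> x01; elim: k => [|k IH]; first by rewrite expr0; lra.
apply: le_trans IH; rewrite exprSr -mulrA ler_wpM2l //.
  by apply: exprn_ge0; lra.
have k0 : 0 <= k%:R :> R by [].
rewrite -natr1; nra.
Qed.

Lemma gf_surv_le_mean q m x : offspring_gf q -> gf_deriv1 q = m%:E ->
  0 <= x <= 1 -> gf_surv q x <= m * x.
Proof.
move=> hq hm x01; rewrite -lee_fin gf_survE // mulrC EFinM -hm /gf_deriv1.
rewrite -nneseriesZl => [|k _]; last by rewrite lee_fin mulr_ge0 // hq.1.
apply: lee_nneseries => k _.
  rewrite lee_fin mulr_ge0 ?hq.1 //.
  have : 0 <= 1 - x <= 1 by lra.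
  by move=> /(expr_itv01 k); lra.
rewrite -EFinM lee_fin.
have -> : x * (k%:R * q k) = q k * (k%:R * x) by ring.
by rewrite ler_wpM2l ?hq.1 // one_sub_expr_le.
Qed.

(** Second-moment bound for one individual with [k] children: [y / (1 + y)], at
[y = k x], lies above every [2 l y - l ^+ 2 (y + y ^+ 2)], by completing a
square.  Being quadratic in [k], the latter can be averaged over [k]. *)
Lemma one_sub_expr_tangent x l k : 0 <= x <= 1 -> 0 <= l ->
  2 * l * (k%:R * x) <=
  1 - (1 - x) ^+ k + l ^+ 2 * (k%:R * x + (k%:R * x) ^+ 2).
Proof.
move=> x01 l0; have H := expr_one_sub_mul k x01.
have y0 : 0 <= k%:R * x by rewrite mulr_ge0 //; lra.
set y := k%:R * x in H y0 *; set e := _ ^+ k in H *.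
have e1 : e <= (1 + y)^-1 by rewrite -[leRHS]mul1r ler_pdivlMr //; lra.
suff : 2 * l * y <= 1 - (1 + y)^-1 + l ^+ 2 * (y + y ^+ 2) by lra.
have y1 : 0 < 1 + y by lra.
rewrite -subr_ge0.
have -> : 1 - (1 + y)^-1 + l ^+ 2 * (y + y ^+ 2) - 2 * l * y =
  y * (1 + y)^-1 * (1 - l * (1 + y)) ^+ 2 by field; lra.
by rewrite mulr_ge0 ?sqr_ge0 // mulr_ge0 ?invr_ge0 //; lra.
Qed.

(** The average over [k] of [one_sub_expr_tangent] at the value of [l] that makes
it sharpest; this is the Paley-Zygmund inequality for the number of kept
children. *)
Lemma gf_surv_ge q m C x : offspring_gf q -> gf_deriv1 q = m%:E ->
  gf_deriv2 q = C%:E -> 0 < m -> 0 <= C -> 0 <= x <= 1 ->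
  m ^+ 2 * x <= gf_surv q x * (m + (C + m) * x).
Proof.
move=> hq hm hC m0 C0 x01.
have q0 := hq.1.
have D0 : 0 < m + (C + m) * x by nra.
set l := m / (m + (C + m) * x).
have l0 : 0 <= l by rewrite divr_ge0 //; lra.
have : ((2 * l * x * m)%:E <=
    (gf_surv q x)%:E + (l ^+ 2 * (m * x + (C + m) * x ^+ 2))%:E)%E.
  have -> : l ^+ 2 * (m * x + (C + m) * x ^+ 2) =
      l ^+ 2 * (x + x ^+ 2) * m + l ^+ 2 * x ^+ 2 * C by ring.
  rewrite [X in (_ + X)%E]EFinD !(EFinM _ m) (EFinM _ C) -hm -hC gf_survE //.
  rewrite /gf_deriv1 /gf_deriv2.
  have p1 k : (0 <= (k%:R * q k)%:E)%E by rewrite lee_fin mulr_ge0.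
  have p2 k : (0 <= ((k * k.-1)%:R * q k)%:E)%E by rewrite lee_fin mulr_ge0.
  have p3 k : 0 <= q k * (1 - (1 - x) ^+ k).
    rewrite mulr_ge0 //; have : 0 <= 1 - x <= 1 by lra.
    by move=> /(expr_itv01 k); lra.
  have a1 : 0 <= 2 * l * x by nra.
  have a2 : 0 <= l ^+ 2 * (x + x ^+ 2).
    by rewrite mulr_ge0 ?sqr_ge0 // addr_ge0 ?sqr_ge0 //; lra.
  have a3 : 0 <= l ^+ 2 * x ^+ 2 by rewrite mulr_ge0 ?sqr_ge0.
  rewrite -!nneseriesZl //.
  rewrite -nneseriesD; last 2 first.
  - by move=> k _ _; rewrite mule_ge0.
  - by move=> k _ _; rewrite mule_ge0.
  rewrite -nneseriesD; last 2 first.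
  - by move=> k _ _; rewrite lee_fin.
  - by move=> k _ _; rewrite adde_ge0 // mule_ge0.
  apply: lee_nneseries => k _; first by rewrite mule_ge0.
  rewrite -!EFinM -!EFinD lee_fin.
  have H := one_sub_expr_tangent k x01 l0.
  have -> : (k * k.-1)%:R = k%:R ^+ 2 - k%:R :> R.
    case: k {H} => [|k]; first by rewrite mul0n; ring.
    by rewrite /= natrM -natr1; ring.
  rewrite -subr_ge0; set F := (X in 0 <= X).
  have -> : F = q k * (1 - (1 - x) ^+ k + l ^+ 2 * (k%:R * x + (k%:R * x) ^+ 2)
     - 2 * l * (k%:R * x)) by rewrite /F; ring.
  by rewrite mulr_ge0 // subr_ge0.
rewrite -EFinD lee_fin => H.
have E : l ^+ 2 * (m * x + (C + m) * x ^+ 2) = l * m * x.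
  by rewrite /l; field; rewrite gt_eqF.
have {E H}H : l * m * x <= gf_surv q x.
  by rewrite E in H; clear -H; lra.
have -> : m ^+ 2 * x = l * m * x * (m + (C + m) * x).
  by rewrite /l; field; rewrite gt_eqF.
by rewrite ler_wpM2r // ltW.
Qed.

(** The linearised form of [gf_surv_ge]: reciprocals of survival probabilities
obey an affine recursion, which can be iterated. *)
Lemma gf_surv_inv q m C x : offspring_gf q -> gf_deriv1 q = m%:E ->
  gf_deriv2 q = C%:E -> 0 < m -> 0 <= C -> 0 < x <= 1 ->
  0 < gf_surv q x /\ (gf_surv q x)^-1 <= (m * x)^-1 + (C + m) / m ^+ 2.
Proof.
move=> hq hm hC m0 C0 /andP[x0 x1].
have H : m ^+ 2 * x <= gf_surv q x * (m + (C + m) * x).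
  by apply: (gf_surv_ge hq hm hC); rewrite // (ltW x0).
have D0 : 0 < m + (C + m) * x by nra.
have M0 : 0 < m ^+ 2 * x by rewrite mulr_gt0 // exprn_gt0.
have s0 : 0 < gf_surv q x.
  by rewrite -(pmulr_lgt0 _ D0) (lt_le_trans M0).
split=> //.
have -> : (m * x)^-1 + (C + m) / m ^+ 2 = (m + (C + m) * x) / (m ^+ 2 * x).
  by field; rewrite !lt0r_neq0.
by rewrite ler_pdivlMr // mulrC ler_pdivrMr // [leRHS]mulrC.
Qed.

(** [(1 - (1 - x) ^+ k) / x] is a sum of [k] powers of [1 - x], hence decreases in
[x], and its term of degree 1, present when [k >= 2], decreases with slope 1. *)
Lemma sub_expr_ratio (s t : R) k : 0 <= s -> s <= t -> t <= 1 ->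
  0 <= (1 - (1 - s) ^+ k) * t - (1 - (1 - t) ^+ k) * s /\
  ((2 <= k)%N ->
   s * t * (t - s) <= (1 - (1 - s) ^+ k) * t - (1 - (1 - t) ^+ k) * s).
Proof.
move=> s0 st t1.
have E j : (1 - (1 - s) ^+ j.+1) * t - (1 - (1 - t) ^+ j.+1) * s =
    (1 - (1 - s) ^+ j) * t - (1 - (1 - t) ^+ j) * s +
    s * t * ((1 - s) ^+ j - (1 - t) ^+ j) by rewrite !exprS; ring.
have le_expr j : (1 - t) ^+ j <= (1 - s) ^+ j.
  by rewrite lerXn2r ?nnegrE; lra.
have st0 : 0 <= s * t by rewrite mulr_ge0 //; lra.
have pos j : 0 <= (1 - (1 - s) ^+ j) * t - (1 - (1 - t) ^+ j) * s.
  elim: j => [|j IH]; first by rewrite !expr0; lra.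
  by rewrite E addr_ge0 // mulr_ge0 // subr_ge0.
split=> //; case: k => [|[|k]] // _; elim: k => [|k IH].
  by rewrite -subr_ge0 le_eqVlt; apply/orP; left; apply/eqP; ring.
by rewrite E (le_trans IH) // lerDl mulr_ge0 // subr_ge0.
Qed.

(** [gf_surv q x / x] decreases, with a quantitative rate as soon as two children
are possible; written without division. *)
Lemma gf_surv_ratio q k (s t : R) : offspring_gf q -> (2 <= k)%N ->
  0 <= s -> s <= t -> t <= 1 ->
  q k * (s * t * (t - s)) <= gf_surv q s * t - gf_surv q t * s.
Proof.
move=> hq k2 s0 st t1; have q0 := hq.1.
have e0 x j : 0 <= x <= 1 -> 0 <= q j * (1 - (1 - x) ^+ j).
  move=> x01; rewrite mulr_ge0 //; have : 0 <= 1 - x <= 1 by lra.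
  by move=> /(expr_itv01 j); lra.
have s01 : 0 <= s <= 1 by lra.
have t01 : 0 <= t <= 1 by lra.
have c0 : 0 <= s * t * (t - s) by rewrite !mulr_ge0 //; lra.
pose ind j : R := if j == k then q k * (s * t * (t - s)) else 0.
have ind0 j : 0 <= ind j by rewrite /ind; case: eqP => // _; rewrite mulr_ge0.
rewrite lerBrDr -lee_fin EFinD !EFinM !gf_survE //.
have -> : ((q k)%:E * (s * t * (t - s))%:E)%E =
    (\sum_(0 <= j <oo) (ind j)%:E)%E.
  rewrite (@nneseriesD1 _ _ k) //; last by move=> j _; rewrite lee_fin.
  rewrite eseries0 ?adde0 /ind ?eqxx ?EFinM // => j _ /andP[_ /negbTE->] //.
rewrite [X in (_ + X <= _)%E]muleC [X in (_ <= X)%E]muleC.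
rewrite -!nneseriesZl; last 2 first.
- by move=> j _; rewrite lee_fin e0.
- by move=> j _; rewrite lee_fin e0.
rewrite -nneseriesD; last 2 first.
- by move=> j _ _; rewrite lee_fin.
- by move=> j _ _; rewrite -EFinM lee_fin mulr_ge0 // e0.
apply: lee_nneseries => j _.
  by rewrite -EFinM -EFinD lee_fin addr_ge0 // mulr_ge0 // e0.
rewrite -!EFinM -EFinD lee_fin -lerBrDr.
have [pos sup] := sub_expr_ratio j s0 st t1.
have -> : t * (q j * (1 - (1 - s) ^+ j)) - s * (q j * (1 - (1 - t) ^+ j)) =
  q j * ((1 - (1 - s) ^+ j) * t - (1 - (1 - t) ^+ j) * s) by ring.
rewrite /ind; case: eqP => [->|_]; last by rewrite mulr_ge0.
by rewrite ler_wpM2l // (sub_expr_ratio k s0 st t1).2.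
Qed.

(** With at most one child per individual the mean would be at most 1. *)
Lemma exists_two_children q m : offspring_gf q -> gf_deriv1 q = m%:E -> 1 < m ->
  exists2 k, (2 <= k)%N & 0 < q k.
Proof.
move=> hq hm m1; apply: contrapT => /forall2NP H.
have q0 k : (2 <= k)%N -> q k = 0.
  move=> k2; have [//|/negP] := H k.
  by rewrite lt_neqAle hq.1 andbT negbK => /eqP.
have : (gf_deriv1 q <= 1)%E.
  rewrite -hq.2; apply: lee_nneseries => k _.
    by rewrite lee_fin mulr_ge0 // hq.1.
  case: k => [|[|k]]; rewrite lee_fin.
  - by rewrite mul0r hq.1.
  - by rewrite mul1r.
  - by rewrite q0 // mulr0.
by rewrite hm lee_fin leNgt m1.
Qed.

(** The quadratic term [k (k - 1) x ^+ 2 / 2] of the expansion survives up to a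
factor 2 as long as [k x <= 1]. *)
Lemma one_sub_expr_gap x k : 0 <= x -> k%:R * x <= 1 ->
  (k * k.-1)%:R * (x ^+ 2 / 4) <= k%:R * x - (1 - (1 - x) ^+ k).
Proof.
move=> x0; elim: k => [|k IH] kx; first by rewrite expr0; lra.
have k0 : 0 <= k%:R :> R by [].
rewrite -natr1 in kx.
have {}IH : (k * k.-1)%:R * (x ^+ 2 / 4) <= k%:R * x - (1 - (1 - x) ^+ k).
  by apply: IH; nra.
have x01 : 0 <= x <= 1 by nra.
have H := expr_one_sub_mul k x01.
have kx0 : 0 <= k%:R * x by rewrite mulr_ge0.
have kx1 : k%:R * x <= 1 by lra.
have half : k%:R * x / 2 <= 1 - (1 - x) ^+ k.
  set e := _ ^+ k in H *; set y := _ * x in H kx0 kx1 *.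
  have : e <= (1 + y)^-1 by rewrite -[leRHS]mul1r ler_pdivlMr //; lra.
  suff : (1 + y)^-1 <= 1 - y / 2 by lra.
  by rewrite -[leLHS]mul1r ler_pdivrMr; nra.
have -> : k.+1%:R * x - (1 - (1 - x) ^+ k.+1) =
    k%:R * x - (1 - (1 - x) ^+ k) + x * (1 - (1 - x) ^+ k).
  by rewrite -natr1 exprS; ring.
have -> : (k.+1 * k.+1.-1)%:R = (k * k.-1)%:R + 2 * k%:R :> R.
  case: k {IH kx k0 H kx0 kx1 half} => [|k]; first by rewrite !muln0 mulr0 addr0.
  by rewrite /= !natrM -!natr1; ring.
have : x * (k%:R * x / 2) <= x * (1 - (1 - x) ^+ k) by rewrite ler_wpM2l.
rewrite mulrDl; set a := _ * (x ^+ 2 / 4) in IH *.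
have -> : 2 * k%:R * (x ^+ 2 / 4) = x * (k%:R * x / 2) by field.
by move: IH; set b := (1 - x) ^+ k; lra.
Qed.

(** A truncated second derivative already exceeds [4 K]; on the finitely many
indices [k < M] that it involves, [one_sub_expr_gap] applies once
[(M + 1) x <= 1]. *)
Lemma gf_surv_gap q m K : offspring_gf q -> gf_deriv1 q = m%:E ->
  gf_deriv2 q = +oo%E -> 0 <= K ->
  exists2 x0, 0 < x0 &
    forall x, 0 <= x <= x0 -> x <= 1 -> gf_surv q x <= m * x - K * x ^+ 2.
Proof.
move=> hq hm h2 K0; have q0 := hq.1.
have p2 k : 0 <= (k * k.-1)%:R * q k by rewrite mulr_ge0.
have [M HM] : exists M, 4 * K <= \sum_(0 <= k < M) (k * k.-1)%:R * q k.
  apply: contrapT => /forallNP H.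
  have : (gf_deriv2 q <= (4 * K)%:E)%E.
    apply: lime_le; first by apply: is_cvg_nneseries => k _ _; rewrite lee_fin.
    apply: nearW => n; rewrite sumEFin lee_fin ltW // ltNge.
    exact/negP/H.
  by rewrite h2 leye_eq.
exists (M.+1%:R^-1) => [|x /andP[x0 xM] x1]; first by rewrite invr_gt0.
have x01 : 0 <= x <= 1 by rewrite x0.
pose ind k : R := if (k < M)%N then (k * k.-1)%:R * q k * (x ^+ 2 / 4) else 0.
have x4 : 0 <= x ^+ 2 / 4 by rewrite divr_ge0 ?sqr_ge0.
have ind0 k : 0 <= ind k by rewrite /ind; case: ifP => // _; rewrite mulr_ge0.
have e0 j : 0 <= q j * (1 - (1 - x) ^+ j).
  rewrite mulr_ge0 //; have : 0 <= 1 - x <= 1 by lra.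
  by move=> /(expr_itv01 j); lra.
have Kle : ((K * x ^+ 2)%:E <= \sum_(0 <= k <oo) (ind k)%:E)%E.
  apply: le_trans (nneseries_lim_ge M _); last first.
    by move=> k _ _; rewrite lee_fin.
  rewrite sumEFin lee_fin.
  apply: (@le_trans _ _ (4 * K * (x ^+ 2 / 4))).
    by rewrite le_eqVlt; apply/orP; left; apply/eqP; field.
  apply: le_trans (ler_wpM2r x4 HM) _.
  rewrite mulr_suml !big_mkord; apply: ler_sum => k _.
  by rewrite /ind ltn_ord.
rewrite lerBrDr -lee_fin EFinD gf_survE // (mulrC m) (EFinM x) -hm /gf_deriv1.
apply: le_trans (leeD2l _ Kle) _.
rewrite -nneseriesD; last 2 first.
- by move=> k _ _; rewrite lee_fin.
- by move=> k _ _; rewrite lee_fin.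
rewrite -nneseriesZl => [|k _]; last by rewrite lee_fin mulr_ge0.
apply: lee_nneseries => k _.
  by rewrite -EFinD lee_fin addr_ge0.
rewrite -EFinD -EFinM lee_fin /ind.
have -> : x * (k%:R * q k) = q k * (k%:R * x) by ring.
case: ltnP => kM; last by rewrite addr0 ler_wpM2l // one_sub_expr_le.
have kx : k%:R * x <= 1.
  apply: (@le_trans _ _ (M.+1%:R * M.+1%:R^-1)); last by rewrite mulfV.
  by rewrite ler_pM // ler_nat leqW // ltnW.
have := one_sub_expr_gap x0 kx => /(ler_wpM2l (q0 k)).
move: (_%:R) (_%:R) ((1 - x) ^+ k) => a b c.
lra.
Qed.
End OffspringLaw.

(** * Finite words of retention probabilities *)

Section Words.
Context {R : realType}.
Implicit Types (phi : R -> R) (m p x z : R) (l : seq R).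

Lemma expr_small (a e : R) : 0 <= a -> a < 1 -> 0 < e ->
  exists n0, forall n, (n0 <= n)%N -> a ^+ n <= e.
Proof.
move=> a0 a1 e0.
have /cvgrPdist_le /(_ e e0) [N _ H] : (a ^+ n @[n --> \oo] --> (0 : R)).
  by apply: cvg_expr; rewrite ger0_norm.
exists N => n nN; have := H n nN.
by rewrite sub0r normrN ger0_norm // exprn_ge0.
Qed.

Definition is_prob p := 0 < p <= 1.

(** Probability that a branching process thinned by the successive retention
probabilities in [l] is alive after [size l] generations, when [phi] is
[gf_surv] of its offspring law. *)
Definition surv phi l := foldr (fun p x => phi (p * x)) 1 l.

(** Mean size of the thinned population after [size l] generations. *)
Definition wmean m l := \prod_(p <- l) (m * p).

(** Horner form of the sum over the nonempty prefixes of [l] of the inverse of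
[wmean]: with [l] an initial segment of [p], a partial sum of the series in
(i). *)
Definition wsum m l := foldr (fun p x => (1 + x) / (m * p)) 0 l.

Lemma wmean_cat m l1 l2 : wmean m (l1 ++ l2) = wmean m l1 * wmean m l2.
Proof. exact: big_cat. Qed.

Lemma wmean_gt0 m l : 0 < m -> all is_prob l -> 0 < wmean m l.
Proof.
move=> m0; rewrite /wmean; elim: l => [|p l IH] /=; first by rewrite big_nil.
by case/andP=> /andP[p0 _] /IH H; rewrite big_cons !mulr_gt0.
Qed.

Lemma wsum_cat m l1 l2 : 0 < m -> all is_prob l1 ->
  wsum m (l1 ++ l2) = wsum m l1 + wsum m l2 / wmean m l1.
Proof.
move=> m0; elim: l1 => [|p l IH] /=.
  by rewrite /wmean big_nil invr1 mulr1 add0r.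
case/andP=> /andP[p0 _] Hl; rewrite (IH Hl) /wmean big_cons.
have := wmean_gt0 m0 Hl; rewrite /wmean => W0.
by field; rewrite !lt0r_neq0.
Qed.

Section Law.
Context (q : nat -> R) (m : R).
Hypotheses (hq : offspring_gf q) (hm : gf_deriv1 q = m%:E) (m1 : 1 < m).

Let m0 : 0 < m. Proof. exact: lt_trans m1. Qed.

Lemma surv_itv l : all is_prob l -> 0 <= surv (gf_surv q) l <= 1.
Proof.
elim: l => [|p l IH] /=; first by rewrite ler01 lexx.
case/andP=> /andP[p0 p1] /IH /andP[s0 s1]; apply: gf_surv_itv => //.
by rewrite mulr_ge0 ?(ltW p0) // mulr_ile1 // ltW.
Qed.

Lemma surv_cat_le l1 l2 : all is_prob l1 -> all is_prob l2 ->
  surv (gf_surv q) (l1 ++ l2) <= wmean m l1 * surv (gf_surv q) l2.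
Proof.
move=> + H2; elim: l1 => [|p l IH] /=; first by rewrite /wmean big_nil mul1r.
case/andP=> /andP[p0 p1] Hl; rewrite /wmean big_cons.
have /surv_itv /andP[s0 s1] : all is_prob (l ++ l2) by rewrite all_cat Hl.
have ps : 0 <= p * surv (gf_surv q) (l ++ l2) <= 1.
  by rewrite mulr_ge0 ?(ltW p0) // mulr_ile1 // ltW.
apply: le_trans (gf_surv_le_mean hq hm ps) _.
by rewrite -!mulrA !ler_wpM2l ?(ltW p0) ?(ltW m0) // IH.
Qed.

Lemma surv_cat_anti l1 l2 : all is_prob l1 -> all is_prob l2 ->
  surv (gf_surv q) (l1 ++ l2) <= surv (gf_surv q) l1.
Proof.
move=> + H2; elim: l1 => [|p l IH] /=.
  by move=> _; case/andP: (surv_itv H2).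
case/andP=> /andP[p0 p1] Hl.
have /surv_itv /andP[s0 s1] : all is_prob (l ++ l2) by rewrite all_cat Hl.
have /andP[t0 t1] := surv_itv Hl.
apply: gf_surv_mono => //.
- by rewrite mulr_ge0 // ltW.
- by rewrite ler_wpM2l ?(ltW p0) // IH.
- by rewrite mulr_ile1 // ltW.
Qed.

(** The recursion [gf_surv_inv] has the same shape as the one that defines
[wsum]. *)
Lemma surv_inv C l : gf_deriv2 q = C%:E -> 0 <= C -> all is_prob l ->
  0 < surv (gf_surv q) l /\
  (surv (gf_surv q) l)^-1 <= (1 + (C + m) / m ^+ 2) * (1 + wsum m l).
Proof.
move=> hC C0; set c := (C + m) / m ^+ 2.
have c0 : 0 <= c by rewrite divr_ge0 ?exprn_ge0 ?addr_ge0 // ltW.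
elim: l => [|p l IH] /=.
  by move=> _; rewrite ltr01 invr1 addr0 mulr1 lerDl.
case/andP=> /andP[p0 p1] Hl; have [s0 sle] := IH Hl.
have /andP[_ s1] := surv_itv Hl.
have ps : 0 < p * surv (gf_surv q) l <= 1.
  by rewrite mulr_gt0 // mulr_ile1 // ltW.
have [ph phle] := gf_surv_inv hq hm hC m0 C0 ps; split=> //.
apply: le_trans phle _; rewrite -/c mulrA invfM.
have mp0 : 0 < (m * p)^-1 by rewrite invr_gt0 mulr_gt0.
apply: (@le_trans _ _ ((m * p)^-1 * ((1 + c) * (1 + wsum m l)) + c)).
  by rewrite lerD2r ler_wpM2l // ltW.
rewrite mulrCA [X in _ <= X]mulrDr mulr1 [(m * p)^-1 * _]mulrC; lra.
Qed.

(** By [gf_surv_ratio] the quotient of the two iterates increases, and its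
distance to 1 shrinks by a fixed factor as long as both stay away from 0, which
[gf_surv_inv] ensures because [1 < m]. *)
Lemma iter_surv_close C z : gf_deriv2 q = C%:E -> 0 <= C -> 0 < z <= 1 ->
  forall e, 0 < e -> exists n0, forall n, (n0 <= n)%N ->
    iter n (gf_surv q) 1 - iter n (gf_surv q) z <= e.
Proof.
move=> hC C0 /andP[z0 z1] e e0.
set c := (C + m) / m ^+ 2.
have c0 : 0 <= c by rewrite divr_ge0 ?exprn_ge0 ?addr_ge0 // ltW.
have m10 : 0 < m - 1 by rewrite subr_gt0.
(* [M / m + c <= M], so that [M^-1] is a lower bound stable under [gf_surv]. *)
pose M := z^-1 + c * m / (m - 1).
have M0 : 0 < M.
  by rewrite ltr_wpDr ?invr_gt0 // divr_ge0 ?(ltW m10) // mulr_ge0 // ltW.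
have [k k2 qk0] := exists_two_children hq hm m1.
have zn n : M^-1 <= iter n (gf_surv q) z <= 1.
  elim: n => [|n /andP[IH1 IH2]] /=.
    rewrite z1 andbT -[leRHS]invrK lef_pV2 ?posrE ?invr_gt0 //.
    by rewrite lerDl divr_ge0 ?(ltW m10) // mulr_ge0 // ltW.
  have w0 : 0 < iter n (gf_surv q) z by apply: lt_le_trans IH1; rewrite invr_gt0.
  have w01 : 0 < iter n (gf_surv q) z <= 1 by rewrite w0.
  have [ph phle] := gf_surv_inv hq hm hC m0 C0 w01.
  rewrite gf_surv_le1 ?(ltW w0) // andbT.
  rewrite -[leRHS]invrK lef_pV2 ?posrE ?invr_gt0 //.
  apply: le_trans phle _; rewrite -/c invfM.
  have H : (iter n (gf_surv q) z)^-1 <= M.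
    by rewrite -[leRHS]invrK lef_pV2 ?posrE ?invr_gt0.
  apply: (@le_trans _ _ (m^-1 * M + c)).
    by rewrite lerD2r ler_wpM2l // invr_ge0 ltW.
  rewrite -subr_ge0.
  have -> : M - (m^-1 * M + c) = z^-1 * ((m - 1) / m).
    by rewrite /M; field; rewrite !lt0r_neq0.
  by rewrite mulr_ge0 ?invr_ge0 ?(ltW z0) // divr_ge0 // ltW.
have yn n : iter n (gf_surv q) z <= iter n (gf_surv q) 1 <= 1.
  elim: n => [|n /andP[IH1 IH2]] /=; first by rewrite z1 lexx.
  have /andP[zM _] := zn n.
  have w0 : 0 <= iter n (gf_surv q) z.
    by apply: le_trans zM; rewrite invr_ge0 ltW.
  by rewrite gf_surv_mono // gf_surv_le1 // IH2 (le_trans w0).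
pose kap := Num.min (q k * M^-1 ^+ 2) 1.
have kap0 : 0 < kap by rewrite lt_min ltr01 mulr_gt0 // exprn_gt0 // invr_gt0.
have kap1 : kap <= 1 by rewrite ge_min lexx orbT.
have lam0 : 0 <= 1 - kap by rewrite subr_ge0.
have key n : iter n (gf_surv q) 1 - iter n (gf_surv q) z <=
    (1 - kap) ^+ n * iter n (gf_surv q) 1.
  elim: n => [|n IH]; first by rewrite expr0 mul1r lerBlDr lerDl ltW.
  have /andP[zM z_1] := zn n; have /andP[zy y1] := yn n.
  have /andP[zy' y1'] := yn n.+1; have /andP[zM' _] := zn n.+1.
  have zz0 : 0 <= iter n (gf_surv q) z.
    by apply: le_trans zM; rewrite invr_ge0 ltW.
  have := gf_surv_ratio hq k2 zz0 zy y1.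
  move: zy' y1' zM' IH zM zy y1 => /=.
  set z' := gf_surv q (iter n _ z); set y' := gf_surv q (iter n _ 1).
  set zz := iter n _ z in zz0 *; set y := iter n _ 1; set L := (1 - kap) ^+ n.
  move=> zy' y1' zM' IH zM zy y1 H.
  have iM0 : 0 < M^-1 by rewrite invr_gt0.
  have zzp : 0 < zz by apply: lt_le_trans zM.
  have yp : 0 < y by apply: lt_le_trans zy.
  have y'p : 0 < y' by apply: lt_le_trans zy'; apply: lt_le_trans zM'.
  have kzy : kap * y' <= q k * (zz * y).
    apply: (@le_trans _ _ kap); first by rewrite ler_piMr // ltW.
    apply: (@le_trans _ _ (q k * M^-1 ^+ 2)); first by rewrite ge_min lexx.
    by rewrite ler_wpM2l ?(ltW qk0) // expr2 ler_pM // ?(ltW iM0) ?(le_trans zM).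
  rewrite -(ler_pM2r yp) exprS.
  have H1 : (y' - z') * y <= (y - zz) * (y' - q k * (zz * y)).
    move: H; set K := q k; nra.
  apply: (le_trans H1).
  have d0 : 0 <= y - zz by rewrite subr_ge0.
  apply: (@le_trans _ _ ((y - zz) * ((1 - kap) * y'))).
    by rewrite ler_wpM2l // mulrBl mul1r lerD2l lerN2.
  have -> : (1 - kap) * L * y' * y = L * y * ((1 - kap) * y') by ring.
  by rewrite ler_wpM2r // mulr_ge0 // ltW.
have lam1 : 1 - kap < 1 by rewrite ltrBlDr ltrDl.
have [n0 Hn0] := expr_small lam0 lam1 e0.
exists n0 => n /Hn0 Hn; apply: le_trans (key n) _; apply: le_trans Hn.
rewrite ler_piMr ?exprn_ge0 //; by case/andP: (yn n).
Qed.

(** The word consists of [n0] letters 1 followed by [n1] letters [p] with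
[m * p = 1 + eta], where [eta = m ^- n0].  With respect
to the line of slope [m], [gf_surv] loses a proportion of at least [2 eta] at
all arguments above [d * eta / m], so one letter [p] contracts [surv] by
[1 - eta] until it has fallen below [d * eta]; the leading letters 1 then
multiply it by at most [1 / eta]. *)
Lemma thinning_word (d : R) : gf_deriv2 q = +oo%E -> 0 < d ->
  exists w, [/\ all is_prob w, 2 <= wmean m w, wsum m w <= (m - 1)^-1 + 1 &
    surv (gf_surv q) w <= d].
Proof.
move=> h2 d0.
have m10 : 0 < m - 1 by rewrite subr_gt0.
(* The relative loss [K * r / m] is then [2 * eta] at [r = d * eta / m]. *)
pose K := 2 * m ^+ 2 / d.
have K0 : 0 <= K by rewrite divr_ge0 ?(ltW d0) // mulr_ge0 // exprn_ge0 // ltW.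
have [x0 x00 gap] := gf_surv_gap hq hm h2 K0.
have [k k2 _] := exists_two_children hq hm m1.
pose e := Num.min (Num.min (x0 * m / d) (m - 1)) (Num.min 2^-1 d^-1).
have e0 : 0 < e.
  by rewrite !lt_min divr_gt0 ?mulr_gt0 // m10 !invr_gt0 d0 ltr0n.
have im0 : 0 <= m^-1 by rewrite invr_ge0 ltW.
have im1 : m^-1 < 1 by rewrite invf_lt1.
have [n0 /(_ n0 (leqnn _)) ell] := expr_small im0 im1 e0.
move: ell; set eta := m^-1 ^+ n0 => ell.
have eta0 : 0 < eta by rewrite exprn_gt0 // invr_gt0.
move: ell; rewrite !le_min => /andP[/andP[E1 E2] /andP[E3 E4]].
have mell : m ^+ n0 = eta^-1 by rewrite /eta exprVn invrK.
pose p := (1 + eta) / m.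
have p0 : 0 < p by rewrite divr_gt0 // addr_gt0.
have p1 : p <= 1 by rewrite ler_pdivrMr // mul1r -lerBrDl.
have pp : is_prob p by rewrite /is_prob p0 p1.
have pone : is_prob (1 : R) by rewrite /is_prob ltr01 lexx.
have all1 n : all is_prob (nseq n 1) by rewrite all_nseq pone orbT.
have allp n : all is_prob (nseq n p) by rewrite all_nseq pp orbT.
pose rho := d * eta.
have rho0 : 0 < rho by rewrite mulr_gt0.
have rho1 : rho <= 1.
  by rewrite /rho mulrC -ler_pdivlMr // mul1r.
have contr s : rho <= s -> s <= 1 -> gf_surv q (p * s) <= (1 - eta) * s.
  move=> rs s1.
  have s0 : 0 < s by apply: lt_le_trans rs.
  pose r := rho / m; pose t := p * s.
  have r0 : 0 < r by rewrite divr_gt0.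
  have t0 : 0 < t by rewrite mulr_gt0.
  have t1 : t <= 1 by rewrite mulr_ile1 // ltW.
  have rt : r <= t.
    rewrite /r /t /p [leRHS]mulrAC ler_wpM2r // (le_trans rs) //.
    by rewrite ler_peMl ?(ltW s0) // lerDl ltW.
  have rx0 : r <= x0.
    rewrite /r ler_pdivrMr // /rho mulrC -ler_pdivlMr //.
  have rb : 0 <= r <= x0 by rewrite rx0 ltW.
  have H1 := gap r rb (le_trans rt t1).
  have H2 := gf_surv_ratio hq k2 (ltW r0) rt t1.
  have H3 : 0 <= q k * (r * t * (t - r)).
    apply: mulr_ge0; first exact: hq.1.
    by rewrite mulr_ge0 ?subr_ge0 // mulr_ge0 // ltW.
  have {}H2 : gf_surv q t * r <= gf_surv q r * t by lra.
  rewrite -/t -(ler_pM2r r0); apply: le_trans H2 _.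
  apply: (@le_trans _ _ ((m * r - K * r ^+ 2) * t)).
    by rewrite ler_wpM2r // ltW.
  have -> : (m * r - K * r ^+ 2) * t = (1 + eta) * (1 - 2 * eta) * s * r.
    by rewrite /t /r /K /rho /p; field; rewrite !lt0r_neq0.
  rewrite ler_wpM2r ?(ltW r0) // ler_wpM2r ?(ltW s0) //.
  by have := sqr_ge0 eta; nra.
have eta1 : 0 <= 1 - eta by rewrite subr_ge0 (le_trans E3) // invf_le1 // ler1n.
have decay n : surv (gf_surv q) (nseq n p) <= rho \/
    surv (gf_surv q) (nseq n p) <= (1 - eta) ^+ n.
  elim: n => [|n IH] /=; first by right; rewrite expr0.
  have /andP[s0 s1] := surv_itv (allp n).
  case: (lerP rho (surv (gf_surv q) (nseq n p))) => [rs|/ltW sr].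
    case: IH => [sr|IH].
      left; apply: (le_trans (contr _ rs s1)); apply: le_trans sr.
      by rewrite ler_piMl // lerBlDr lerDl ltW.
    right; apply: (le_trans (contr _ rs s1)).
    by rewrite exprS ler_wpM2l.
  left; apply: (@le_trans _ _ (gf_surv q (p * rho))).
    apply: gf_surv_mono => //.
    - by rewrite mulr_ge0 // ltW.
    - by rewrite ler_wpM2l // ltW.
    - by rewrite mulr_ile1 // ltW.
  apply: (le_trans (contr _ (lexx _) rho1)).
  by rewrite ler_piMl ?(ltW rho0) // lerBlDr lerDl ltW.
have eta1' : 1 - eta < 1 by rewrite ltrBlDr ltrDl.
have [n1 /(_ n1 (leqnn _)) Hn1] := expr_small eta1 eta1' rho0.
have svn : surv (gf_surv q) (nseq n1 p) <= rho.
  by case: (decay n1) => // /le_trans; apply.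
have p_mean : m * p = 1 + eta by rewrite /p mulrCA mulfV ?mulr1 // lt0r_neq0.
have meanp n : 1 <= wmean m (nseq n p).
  rewrite /wmean; elim: n => [|n IH]; first by rewrite big_nil.
  by rewrite big_cons p_mean mulr_ege1 // lerDl ltW.
have mean1 n : wmean m (nseq n 1) = m ^+ n.
  rewrite /wmean; elim: n => [|n IH]; first by rewrite big_nil.
  by rewrite big_cons IH mulr1 exprS.
have sump n : wsum m (nseq n p) <= eta^-1.
  elim: n => [|n IH] /=; first by rewrite invr_ge0 ltW.
  rewrite p_mean ler_pdivrMr; last by rewrite addr_gt0.
  by rewrite mulrDr mulr1 mulVf ?lt0r_neq0 // addrC lerD2r.
have sum1 n w : wsum m (nseq n 1 ++ w) <= (m - 1)^-1 + m^-1 ^+ n * wsum m w.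
  elim: n => [|n IH] /=.
    by rewrite expr0 mul1r lerDr invr_ge0 ltW.
  rewrite mulr1 ler_pdivrMr //.
  have -> : ((m - 1)^-1 + m^-1 ^+ n.+1 * wsum m w) * m =
    1 + ((m - 1)^-1 + m^-1 ^+ n * wsum m w).
    by rewrite exprS; field; rewrite !lt0r_neq0.
  by rewrite lerD2l.
exists (nseq n0 1 ++ nseq n1 p); split.
- by rewrite all_cat all1 allp.
- rewrite wmean_cat mean1 mell -[2]mulr1 ler_pM //.
  by rewrite -[2]invrK lef_pV2 // posrE invr_gt0.
- apply: le_trans (sum1 _ _) _; rewrite lerD2l -/eta.
  by rewrite mulrC -ler_pdivlMr // mul1r.
- apply: le_trans (surv_cat_le (all1 _) (allp _)) _.
  rewrite mean1 mell mulrC ler_pdivrMr //.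
Qed.

End Law.
End Words.

(** * The thinning sequence *)

Section Thinning.
Context {R : realType}.

(** The retention probabilities of the [n] generations that follow generation
[k]. *)
Definition word (p : nat -> R) k n := [seq p i | i <- iota k.+1 n].

Lemma word_prob (p : nat -> R) k n : (forall i, is_prob (p i)) ->
  all is_prob (word p k n).
Proof. by move=> hp; apply/allP => _ /mapP[i _ ->]. Qed.

Lemma wsum_word (m : R) (p : nat -> R) n : 0 < m -> (forall i, is_prob (p i)) ->
  wsum m (word p 0 n) =
  \sum_(1 <= j < n.+1) \prod_(1 <= k < j.+1) (m * p k)^-1.
Proof.
move=> m0 hp.
have meanE j : (wmean m (word p 0 j))^-1 = \prod_(1 <= k < j.+1) (m * p k)^-1.
  by rewrite /wmean big_map -prodfV /index_iota subSS subn0.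
elim: n => [|n IH]; first by rewrite big_geq.
have -> : word p 0 n.+1 = word p 0 n ++ [:: p n.+1].
  by rewrite /word -(addn1 n) iotaD map_cat add1n addn1.
rewrite wsum_cat //; last exact: word_prob.
rewrite big_nat_recr //= -IH addr0 div1r meanE; congr (_ + _).
by rewrite [in RHS]big_nat_recr //= mulrC.
Qed.

(** The numbers [K j] are the generations at which the words of [thinning_word]
begin.  The word that starts at [K j] is required to have [surv] at most
[2^-j] divided by the mean population up to [K j], since this mean is the
factor that the earlier letters may contribute.  As every word at least
doubles the mean, sums that start at some [K i] are dominated by a geometric
series with ratio 1/2. *)
Lemma exists_thinning (q : nat -> R) (m : R) : offspring_gf q ->
  gf_deriv1 q = m%:E -> 1 < m -> gf_deriv2 q = +oo%E ->
  exists p : nat -> R, exists K : nat -> nat, exists S : R,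
  [/\ forall i, is_prob (p i), K 0%N = 0%N, forall j, (j <= K j)%N,
      forall j, surv (gf_surv q) (word p 0 (K j)) <= 2 * 2^-1 ^+ j &
      forall i j, (i <= j)%N -> wsum m (word p (K i) (K j - K i)) <= S].
Proof.
move=> hq hm m1 h2; have m0 : 0 < m by apply: lt_trans m1.
pose C := (m - 1)^-1 + 1.
have C0 : 0 <= C by rewrite addr_ge0 // invr_ge0 subr_ge0 ltW.
have /choice [blk Hblk] : forall d : R, exists w, 0 < d ->
    [/\ all is_prob w, 2 <= wmean m w, wsum m w <= C & surv (gf_surv q) w <= d].
  move=> d; case: (ltrP 0 d) => [d0|_]; last by exists [::].
  by have [w Hw] := thinning_word hq hm m1 h2 d0; exists w.
have [W [W0 WS']] : exists W : nat -> seq R, W 0%N = [::] /\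
    forall j, W j.+1 = W j ++ blk (2^-1 ^+ j / wmean m (W j)).
  by exists (fix W j := if j is j'.+1
    then W j' ++ blk (2^-1 ^+ j' / wmean m (W j')) else [::]).
pose b j := blk (2^-1 ^+ j / wmean m (W j)).
have half0 j : 0 < 2^-1 ^+ j :> R by rewrite exprn_gt0.
have Wp j : all is_prob (W j).
  elim: j => [|j IH]; rewrite ?W0 // WS' all_cat IH.
  by case: (Hblk (2^-1 ^+ j / wmean m (W j))) => //; rewrite divr_gt0 ?wmean_gt0.
have bP j : [/\ all is_prob (b j), 2 <= wmean m (b j), wsum m (b j) <= C &
    surv (gf_surv q) (b j) <= 2^-1 ^+ j / wmean m (W j)].
  by apply: Hblk; rewrite divr_gt0 ?wmean_gt0.
have WS j : W j.+1 = W j ++ b j by exact: WS'.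
pose K j := size (W j).
have Kge j : (j <= K j)%N.
  elim: j => [|j IH] //; rewrite /K WS size_cat -addn1 leq_add // lt0n.
  apply/eqP => /size0nil b0; have [_ + _ _] := bP j.
  by rewrite b0 /wmean big_nil; lra.
(* [V i d] is the concatenation of the [d] words from the [i]-th on. *)
pose V := fix V i d := if d is d'.+1 then b i ++ V i.+1 d' else [::].
have WV i d : W (i + d)%N = W i ++ V i d.
  elim: d i => [|d IH] i; first by rewrite addn0 cats0.
  by rewrite addnS -addSn IH WS /= catA.
have VS i d : wsum m (V i d) <= 2 * C.
  elim: d i => [|d IH] i; first by rewrite mulr_ge0.
  have [bp b2 bC _] := bP i; have := IH i.+1; rewrite /= wsum_cat // => H.
  have b0 : 0 < wmean m (b i) by apply: lt_le_trans b2.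
  have {}H : wsum m (V i.+1 d) / wmean m (b i) <= C.
    rewrite ler_pdivrMr // (le_trans H) // mulrC ler_wpM2l //.
  by lra.
pose p k := nth 1 (W k) k.-1.
have pW j i : (i < K j)%N -> p i.+1 = nth 1 (W j) i.
  move=> ij; have iK : (i < size (W i.+1))%N by apply: Kge.
  have -> : p i.+1 = nth 1 (W i.+1) i by [].
  case: (leqP i.+1 j) => [|/ltnW] /subnKC E; rewrite -E WV nth_cat ?iK //.
  by rewrite /K in ij; rewrite ij.
have pp i : is_prob (p i).
  rewrite /p; case: (ltnP i.-1 (size (W i))) => H; last first.
    by rewrite nth_default // /is_prob ltr01 lexx.
  by have /all_nthP -> := Wp i.
have WE j : word p 0 (K j) = W j.
  apply: (@eq_from_nth _ 1) => [|i]; rewrite size_map size_iota // => ij.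
  by rewrite (nth_map 0%N) ?size_iota // nth_iota // add1n (pW j).
exists p, K, (2 * C); split=> //; first by rewrite /K W0.
- case=> [|j]; first by rewrite expr0 mulr1 WE W0 /= ler1n.
  rewrite WE WS; have [bp _ _ bs] := bP j.
  apply: le_trans (surv_cat_le hq hm m1 (Wp j) bp) _.
  rewrite exprS mulVKf //; apply: le_trans (ler_wpM2l _ bs) _.
    by rewrite ltW // wmean_gt0.
  by rewrite mulrC divfK // lt0r_neq0 // wmean_gt0.
- move=> i j ij; apply: le_trans (VS i (j - i)%N).
  have := WV i (j - i)%N; rewrite subnKC // => E.
  suff -> : word p (K i) (K j - K i) = V i (j - i)%N by [].
  have Kij : (K i <= K j)%N by rewrite /K E size_cat leq_addr.
  have cat : word p 0 (K j) = word p 0 (K i) ++ word p (K i) (K j - K i).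
    by rewrite -{1}(subnKC Kij) /word iotaD map_cat add1n.
  move: cat; rewrite !WE E => /eqP.
  by rewrite eqseq_cat // eqxx => /eqP ->.
Qed.

Lemma thinning_sum (m S : R) (p : nat -> R) (K : nat -> nat) : 0 < m ->
  (forall i, is_prob (p i)) -> (forall j, (j <= K j)%N) ->
  (forall j, wsum m (word p 0 (K j)) <= S) ->
  (\sum_(1 <= n <oo) (\prod_(1 <= k < n.+1) (m * p k)^-1)%:E < +oo)%E.
Proof.
move=> m0 hp hK hS.
have pos n : 0 <= \prod_(1 <= k < n.+1) (m * p k)^-1.
  apply: prodr_ge0 => i _; rewrite invr_ge0 mulr_ge0 ?(ltW m0) //.
  by have /andP[/ltW] := hp i.
apply: (@le_lt_trans _ _ S%:E); last exact: ltry.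
apply: lime_le; first by apply: is_cvg_nneseries => k _ _; rewrite lee_fin.
apply: nearW => n; rewrite sumEFin lee_fin; apply: le_trans (hS n).
rewrite wsum_word //; case: n => [|n]; first by rewrite big_geq // sumr_ge0.
rewrite [leRHS](@big_cat_nat _ _ _ n.+1) //=; last by rewrite ltnW // ltnS hK.
by rewrite lerDl sumr_ge0.
Qed.

End Thinning.

(** * Offspring laws of thinned trees *)

Section ThinnedLaw.
Context {R : realType} (q : nat -> R) (p : R).
Hypotheses (hq : offspring_gf q) (p01 : 0 <= p <= 1).

(** Probability that there are [j] children and exactly [k] of them are
kept. *)
Definition thin_term j k : R :=
  q j * ('C(j, k)%:R * (p ^+ k * (1 - p) ^+ (j - k))).

Definition thin k : R := fine (\sum_(0 <= j <oo) (thin_term j k)%:E)%E.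

Let thin_term_ge0 j k : 0 <= thin_term j k.
Proof.
case/andP: p01 => p0 p1.
by rewrite mulr_ge0 ?hq.1 // !mulr_ge0 // exprn_ge0 // subr_ge0.
Qed.

Lemma thin_term_sum j z : 0 <= z <= 1 ->
  (\sum_(0 <= k <oo) (thin_term j k * z ^+ k)%:E =
   (q j * (1 - p + p * z) ^+ j)%:E)%E.
Proof.
case/andP=> z0 z1; rewrite (nneseries_split 0 j.+1); last first.
  by move=> k _; rewrite lee_fin mulr_ge0 ?exprn_ge0.
rewrite eseries0 ?adde0; last first.
  by move=> k jk _; rewrite /thin_term bin_small // mul0r mulr0 mul0r.
rewrite sumEFin exprDn mulr_sumr big_mkord; congr EFin.
apply: eq_bigr => i _; rewrite /thin_term exprMn -mulr_natl; ring.
Qed.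

Let thin_term_le j k : thin_term j k <= q j.
Proof.
have := @thin_term_sum j 1; rewrite ler01 lexx => /(_ isT).
rewrite mulr1 subrK expr1n mulr1 -lee_fin => <-.
apply: le_trans (nneseries_lim_ge k.+1 _); last first.
  by move=> i _ _; rewrite lee_fin mulr_ge0.
rewrite sumEFin lee_fin big_nat_recr //= expr1n mulr1 lerDr.
by apply: sumr_ge0 => i _; rewrite expr1n mulr1.
Qed.

Lemma thinE k : ((thin k)%:E = \sum_(0 <= j <oo) (thin_term j k)%:E)%E.
Proof.
rewrite /thin fineK // ge0_fin_numE; last first.
  by apply: nneseries_ge0 => j _ _; rewrite lee_fin.
apply: (@le_lt_trans _ _ (1 : R)%:E); last exact: ltry.
by rewrite -hq.2; apply: lee_nneseries => j _; rewrite lee_fin.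
Qed.

Lemma thin_ge0 k : 0 <= thin k.
Proof.
by rewrite -lee_fin thinE; apply: nneseries_ge0 => j _ _; rewrite lee_fin.
Qed.

Lemma thin_sum z : 0 <= z <= 1 ->
  (\sum_(0 <= k <oo) (thin k * z ^+ k)%:E = (gf_eval q (1 - p + p * z))%:E)%E.
Proof.
move=> z01; have /andP[z0 z1] := z01; rewrite gf_evalE //; last first.
  by case/andP: p01 => p0 p1; apply/andP; split; nra.
rewrite -[RHS](eq_eseriesr (fun j _ => thin_term_sum j z01)).
rewrite nneseries_interchange; last first.
  by move=> i j; rewrite lee_fin mulr_ge0 ?exprn_ge0.
apply: eq_eseriesr => k _; rewrite mulrC EFinM thinE -nneseriesZl; last first.
  by move=> j _; rewrite lee_fin.
by apply: eq_eseriesr => j _; rewrite -EFinM mulrC.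
Qed.

Lemma offspring_thin : offspring_gf thin.
Proof.
split; first exact: thin_ge0.
have := @thin_sum 1; rewrite ler01 lexx => /(_ isT).
under eq_eseriesr do rewrite expr1n mulr1.
move=> ->; rewrite mulr1 subrK gf_evalE ?ler01 ?lexx //.
by rewrite -hq.2; under eq_eseriesr do rewrite expr1n mulr1.
Qed.

Lemma gf_eval_thin z : 0 <= z <= 1 ->
  gf_eval thin z = gf_eval q (1 - p + p * z).
Proof.
move=> z01; apply: EFin_inj; rewrite -thin_sum // -gf_evalE //.
exact: offspring_thin.
Qed.

End ThinnedLaw.

(** * Independence of disjoint groups of variables *)

Section SigmaAlgebra.
Context {T : Type} (G : set (set T)).
Hypothesis sG : sigma_algebra setT G.

Lemma sa_setC A : G A -> G (~` A).
Proof. by case: sG => _ + _ => /[apply]; rewrite setTD. Qed.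

Lemma sa_setT : G setT.
Proof. by rewrite -setC0; apply: sa_setC; case: sG. Qed.

Lemma sa_ex (F : nat -> set T) : (forall i, G (F i)) ->
  G [set w | exists i, F i w].
Proof.
move=> GF; have -> : [set w | exists i, F i w] = \bigcup_i F i.
  by apply/seteqP; split => w [i]; [exists i | exists i].
by case: sG => _ _; exact.
Qed.

Lemma sa_all (F : nat -> set T) : (forall i, G (F i)) ->
  G [set w | forall i, F i w].
Proof.
move=> GF; have -> : [set w | forall i, F i w] =
    ~` [set w | exists i, (~` F i) w].
  apply/seteqP; split => w /=; first by move=> H [i]; exact.
  by move=> /forallNP H i; apply: contrapT; exact: H.
by apply/sa_setC/sa_ex => i; exact: sa_setC.
Qed.

Lemma sa_and A B : G A -> G B -> G [set w | A w /\ B w].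
Proof.
move=> GA GB; have -> : [set w | A w /\ B w] =
    [set w | forall i : nat, (if i is 0%N then A else B) w].
  apply/seteqP; split => w /=; first by case=> ? ? [].
  by move=> H; split; [exact: (H 0%N) | exact: (H 1%N)].
by apply: sa_all => -[].
Qed.

Lemma sa_cst (Q : Prop) : G [set w | Q].
Proof.
case: (pselect Q) => HQ.
  by have -> : [set _ | Q] = [set: T]; [apply/seteqP; split | exact: sa_setT].
have -> : [set _ | Q] = set0 :> set T by apply/seteqP; split.
by case: sG.
Qed.

Lemma sa_imply A B : G A -> G B -> G [set w | A w -> B w].
Proof.
move=> GA GB; have -> : [set w | A w -> B w] =
    ~` [set w | A w /\ (~` B) w].
  apply/seteqP; split => w /=; first by move=> H [/H].
  by move=> H Aw; apply: contrapT => Bw; exact: H.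
by apply/sa_setC/sa_and => //; exact: sa_setC.
Qed.

End SigmaAlgebra.

Section Independence.
Context {R : realType} {d : measure_display} {T : measurableType d}
  (P : probability T R) {I : eqType} (C : I -> set (set T)).

(** Mutual independence of pi-systems of events, one for each index. *)
Record indep_systems : Prop := IndepSystems {
  sysT : forall i, C i setT ;
  sysI : forall i A B, C i A -> C i B -> C i (A `&` B) ;
  sysM : forall i, C i `<=` measurable ;
  sysP : forall (s : seq I) (E : I -> set T), uniq s -> (forall i, C i (E i)) ->
    P (\bigcap_(i in [set` s]) E i) = (\prod_(i <- s) P (E i))%E }.

(** Finite intersections of events whose indices lie in [D]: a pi-system that
generates [sig D], the events determined by the variables with indices in
[D]. *)
Definition cyl (D : set I) : set (set T) :=
  [set A | exists (s : seq I) (E : I -> set T),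
    [/\ forall i, C i (E i), [set` s] `<=` D &
     A = \bigcap_(i in [set` s]) E i]].

Definition sig (D : set I) := <<s cyl D >>.

Lemma sig_sigma D : sigma_algebra setT (sig D).
Proof. exact: smallest_sigma_algebra. Qed.

Lemma cyl_mono D D' : D `<=` D' -> cyl D `<=` cyl D'.
Proof.
move=> DD' _ [s [E [CE sD ->]]]; exists s, E; split=> //.
exact: subset_trans DD'.
Qed.

Lemma sig_mono D D' A : D `<=` D' -> sig D A -> sig D' A.
Proof.
move=> DD'; apply: sub_smallest2r A; first exact: sig_sigma.
exact: cyl_mono.
Qed.

Hypothesis HC : indep_systems.

Lemma sig_in D i A : D i -> C i A -> sig D A.
Proof.
move=> Di CA; apply: sub_gen_smallest.
exists [:: i], (fun j => if j == i then A else setT); split.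
- by move=> j; case: eqP => [->|] // _; exact: sysT.
- by move=> j /=; rewrite inE => /eqP ->.
- apply/seteqP; split => [w Aw j /=|w /(_ i)]; rewrite /= ?inE.
    by move=> ->.
  by rewrite eqxx; exact.
Qed.

Lemma cyl_measurable D : cyl D `<=` measurable.
Proof.
move=> _ [s [E [CE _ ->]]]; apply: fin_bigcap_measurable => [|i _].
  exact: finite_seq.
exact: sysM (CE i).
Qed.

Lemma sig_measurable D : sig D `<=` measurable.
Proof.
apply: smallest_sub; first exact: sigma_algebra_measurable.
exact: cyl_measurable.
Qed.

Lemma cyl_setI D : setI_closed (cyl D).
Proof.
move=> _ _ [s1 [E1 [CE1 sD1 ->]]] [s2 [E2 [CE2 sD2 ->]]].
exists (s1 ++ s2), (fun i => (if i \in s1 then E1 i else setT) `&`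
                             (if i \in s2 then E2 i else setT)); split.
- by move=> i; apply: sysI => //; case: ifP => _ //; exact: sysT.
- by move=> i /=; rewrite mem_cat => /orP[/sD1|/sD2].
- apply/seteqP; split => [w [H1 H2] i /= _|w H].
    by split; case: ifP => // si; [exact: H1 | exact: H2].
  split=> i /= si.
    by have := H i; rewrite /= mem_cat si => /(_ isT) [].
  by have := H i; rewrite /= mem_cat si orbT => /(_ isT) [].
Qed.

Lemma cyl_indep D1 D2 A B : D1 `&` D2 = set0 -> cyl D1 A -> cyl D2 B ->
  (P (A `&` B) = P A * P B)%E.
Proof.
move=> D12 [s1 [E1 [CE1 sD1 ->]]] [s2 [E2 [CE2 sD2 ->]]].
have dis i : i \in s2 -> i \in s1 = false.
  move=> i2; apply/negP => i1; suff : (D1 `&` D2) i by rewrite D12.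
  by split; [exact: sD1 | exact: sD2].
pose E i := if i \in s1 then E1 i else E2 i.
have CE i : C i (E i) by rewrite /E; case: ifP.
have u1 := undup_uniq s1; have u2 := undup_uniq s2.
have u12 : uniq (undup s1 ++ undup s2).
  rewrite cat_uniq u1 u2 andbT; apply/hasPn => i /=.
  by rewrite !mem_undup => /dis ->.
have capE (s : seq I) (F : I -> set T) :
    \bigcap_(i in [set` undup s]) F i = \bigcap_(i in [set` s]) F i.
  have -> // : [set` undup s] = [set` s].
  by apply/seteqP; split => i /=; rewrite mem_undup.
have -> : \bigcap_(i in [set` s1]) E1 i = \bigcap_(i in [set` undup s1]) E i.
  by rewrite capE; apply: eq_bigcapr => i /= si; rewrite /E si.
have -> : \bigcap_(i in [set` s2]) E2 i = \bigcap_(i in [set` undup s2]) E i.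
  by rewrite capE; apply: eq_bigcapr => i /= si; rewrite /E dis.
have -> : \bigcap_(i in [set` undup s1]) E i `&`
          \bigcap_(i in [set` undup s2]) E i =
          \bigcap_(i in [set` undup s1 ++ undup s2]) E i.
  apply/seteqP; split => [w [H1 H2] i /=|w H].
    by rewrite mem_cat => /orP[/H1|/H2].
  by split=> i /= si; apply: H; rewrite /= mem_cat si ?orbT.
by rewrite !sysP // big_cat.
Qed.

Lemma indep_dynkin B : measurable B ->
  dynkin [set A | measurable A /\ (P (A `&` B) = P A * P B)%E].
Proof.
move=> mB; split=> [|A [mA AB]|F tF HF] /=.
- by rewrite setTI probability_setT mul1e.
- split; first exact: measurableC.
  have -> : P (~` A `&` B) = (P B - P A * P B)%E.
    rewrite -AB setIC -setDE [A `&` B]setIC measureD // ltey_eq.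
    by rewrite fin_num_measure.
  rewrite probability_setC // muleBl ?fin_num_measure ?mul1e //.
- have mF n : measurable (F n) by case: (HF n).
  split; first exact: bigcup_measurable.
  rewrite setI_bigcupl measure_semi_bigcup; last 3 first.
  + by move=> i; exact: measurableI.
  + by apply: trivIset_setIr.
  + by apply: bigcup_measurable => i _; exact: measurableI.
  rewrite measure_semi_bigcup //; last exact: bigcup_measurable.
  have PB : P B = (fine (P B))%:E by rewrite fineK // fin_num_measure.
  rewrite muleC PB -nneseriesZl //; apply: eq_eseriesr => i _.
  by rewrite -PB muleC; case: (HF i).
Qed.

(** Dynkin's theorem, applied to one argument and then to the other. *)
Lemma sig_indep D1 D2 A B : D1 `&` D2 = set0 -> sig D1 A -> sig D2 B ->
  (P (A `&` B) = P A * P B)%E.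
Proof.
move=> D12 sA sB.
have dyn D (G : set (set T)) : dynkin G -> cyl D `<=` G -> sig D `<=` G.
  move=> dG DG; rewrite /sig -setI_closed_g_dynkin_g_sigma_algebra.
    exact: smallest_sub.
  exact: cyl_setI.
have H1 B' : cyl D2 B' -> (P (A `&` B') = P A * P B')%E.
  move=> cB; have mB' := cyl_measurable cB.
  apply: (dyn D1 _ (indep_dynkin mB') _ A sA).2 => A' cA.
  by split; [exact: cyl_measurable cA | exact: cyl_indep cA cB].
rewrite setIC muleC.
apply: (dyn D2 _ (indep_dynkin (sig_measurable sA)) _ B sB).2 => B' cB.
by split; [exact: cyl_measurable cB | rewrite setIC muleC H1].
Qed.

Lemma sig_forall_lt (D : nat -> set I) (Z : nat -> set T) n :
  (forall i, sig (D i) (Z i)) ->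
  sig (\bigcup_(i < n) D i) [set w | forall i, (i < n)%N -> Z i w].
Proof.
move=> sZ; apply: (sa_all (sig_sigma _)) => i.
have [ni|ni] := ltnP i n.
  have -> : (fun w => true -> Z i w) = Z i.
    by apply/funext => w; apply/propext; split=> // /(_ isT).
  by apply: (sig_mono _ (sZ i)) => x Dx; exists i.
have -> : (fun w => false -> Z i w) = setT.
  by apply/funext => w; apply/propext; split.
exact: (sa_setT (sig_sigma _)).
Qed.

Lemma sig_indep_prod (D : nat -> set I) (Z : nat -> set T) k :
  (forall i j, i != j -> D i `&` D j = set0) -> (forall i, sig (D i) (Z i)) ->
  (P [set w | forall i, (i < k)%N -> Z i w] = \prod_(i < k) P (Z i))%E.
Proof.
move=> dD sZ.
elim: k => [|k IH].
  rewrite big_ord0 (_ : [set _ | _] = setT) ?probability_setT //.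
  by apply/seteqP; split.
rewrite big_ord_recr /= -IH.
rewrite (_ : [set _ | _] = [set w | forall i, (i < k)%N -> Z i w] `&` Z k).
  apply: (@sig_indep (\bigcup_(i < k) D i) (D k)).
  - rewrite setI_bigcupl bigcup0 // => i /= ik; apply: dD.
    by rewrite neq_ltn ik.
  - exact: sig_forall_lt.
  - exact: sZ.
apply/seteqP; split => w /= H.
  by split=> [i ik|]; apply: H => //; rewrite ltnS ltnW.
by move=> i; rewrite ltnS leq_eqVlt => /orP[/eqP ->|]; [exact: H.2 | exact: H.1].
Qed.

(** Decomposition according to the value of [c], the number of children; [Z i] is
an event on the subtree of the child [i]. *)
Lemma branching_step (q : nat -> R) (c : T -> nat) (D0 : set I)
    (D : nat -> set I) (Z : nat -> set T) :
  (forall k, sig D0 [set w | c w = k]) ->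
  (forall k, P [set w | c w = k] = (q k)%:E) ->
  (forall i, D0 `&` D i = set0) ->
  (forall i j, i != j -> D i `&` D j = set0) -> (forall i, sig (D i) (Z i)) ->
  (P [set w | forall i, (i < c w)%N -> Z i w] =
   \sum_(0 <= k <oo) ((q k)%:E * \prod_(i < k) P (Z i)))%E.
Proof.
move=> sc Pc dD0 dD sZ.
pose F k := [set w | c w = k] `&` [set w | forall i, (i < k)%N -> Z i w].
have sF k : sig (\bigcup_(i < k) D i) [set w | forall i, (i < k)%N -> Z i w].
  exact: sig_forall_lt.
have mF k : measurable (F k).
  by apply: measurableI; apply: sig_measurable; [exact: sc | exact: sF].
have -> : [set w | forall i, (i < c w)%N -> Z i w] = \bigcup_k F k.
  apply/seteqP; split => w /= H; first by exists (c w).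
  by case: H => k _ [/= ->].
rewrite measure_semi_bigcup //; last 2 first.
- apply/trivIsetP => i j _ _ ij; apply/seteqP.
  by split => // w [[/= ci _] [/= cj _]]; rewrite -ci -cj eqxx in ij.
- exact: bigcup_measurable.
apply: eq_eseriesr => k _.
rewrite -Pc -(sig_indep_prod k dD sZ); apply: (sig_indep _ (sc k) (sF k)).
by rewrite setI_bigcupr bigcup0.
Qed.

End Independence.

(** * Open paths in labelled trees *)

Section Reach.
Context {Om : Type} (c : seq nat -> Om -> nat) (o : seq nat -> set Om).

(** [reach n u]: from [u], whose number of children is [c u], there is a
descending path of [n] steps all of whose vertices after [u] are open. *)
Fixpoint reach n u : set Om :=
  if n is n'.+1 then [set w | exists i, (i < c u w)%N /\
    (o (rcons u i) w /\ reach n' (rcons u i) w)] else setT.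

Definition percolates u : set Om := [set w | forall n, reach n u w].

Lemma reach_anti n u : reach n.+1 u `<=` reach n u.
Proof.
elim: n u => [|n IH] u w //= [i [iu [oi ri]]].
by exists i; split=> //; split=> //; apply: IH.
Qed.

Lemma reach_antiW n n' u : (n <= n')%N -> reach n' u `<=` reach n u.
Proof.
move=> /subnK <-; elim: (n' - n)%N => [|k IH] //.
by rewrite addSn; apply: subset_trans IH; exact: reach_anti.
Qed.

Lemma reach_path (v : nat -> seq nat) n k w :
  (forall j, (k <= j < k + n)%N -> exists i,
     [/\ v j.+1 = rcons (v j) i, (i < c (v j) w)%N & o (v j.+1) w]) ->
  reach n (v k) w.
Proof.
elim: n k => [|n IH] k H //=.
have [|i [vi ik ok]] := H k; first by rewrite leqnn addnS ltnS leq_addr.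
exists i; rewrite -vi; split=> //; split=> //; apply: IH => j /andP[kj jn].
by apply: H; rewrite (ltnW kj) addnS -addSn.
Qed.

(** Koenig's lemma: otherwise each of the finitely many children is closed or
has a bounded depth, and so has [u]. *)
Lemma percolates_child u w : percolates u w ->
  exists i, [/\ (i < c u w)%N, o (rcons u i) w & percolates (rcons u i) w].
Proof.
move=> Hu; apply: contrapT => /forallNP H.
have /choice [f Hf] : forall i, exists n, (i < c u w)%N -> o (rcons u i) w ->
    ~ reach n (rcons u i) w.
  move=> i; case: (pselect ((i < c u w)%N /\ o (rcons u i) w)) => [[iu oi]|N].
    have /existsNP [n Hn] : ~ percolates (rcons u i) w.
      by move=> Hp; apply: (H i).
    by exists n.
  by exists 0%N => iu oi; case: N.
have /= [i [iu [oi ri]]] := Hu (\max_(i < c u w) f i).+1.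
apply: (Hf i iu oi); apply: reach_antiW ri.
exact: (leq_bigmax (Ordinal iu)).
Qed.

Lemma percolates_path w : percolates [::] w -> exists v : nat -> seq nat,
  v 0%N = [::] /\ forall j, exists i,
     [/\ v j.+1 = rcons (v j) i, (i < c (v j) w)%N & o (v j.+1) w].
Proof.
move=> H0; have /choice [f Hf] : forall u, exists i, percolates u w ->
    [/\ (i < c u w)%N, o (rcons u i) w & percolates (rcons u i) w].
  move=> u; case: (pselect (percolates u w)) => [/percolates_child [i Hi]|N].
    by exists i.
  by exists 0%N.
pose v n := iter n (fun u => rcons u (f u)) [::].
have vp j : percolates (v j) w by elim: j => [|j /Hf []].
exists v; split=> // j; exists (f (v j)); have [fi oi _] := Hf _ (vp j).
by split.
Qed.

Definition desc u : set (seq nat) := [set v | prefix u v].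
(** Strict descendants: the event [reach n u] involves the openness of these, but
the numbers of children of all descendants. *)
Definition sdesc u : set (seq nat) := [set v | prefix u v /\ v != u].

Lemma sdesc_rcons u i : desc (rcons u i) `<=` sdesc u.
Proof.
move=> v /= H; split; first by apply: prefix_trans H; exact: prefix_rcons.
by apply/eqP => vu; move: (size_prefix H); rewrite vu size_rcons ltnn.
Qed.

Lemma desc_rcons u i : desc (rcons u i) `<=` desc u.
Proof. by move=> v /sdesc_rcons []. Qed.

Lemma desc_rcons_inj u i j v : desc (rcons u i) v -> desc (rcons u j) v -> i = j.
Proof.
rewrite /desc /= !prefixE !size_rcons => /eqP -> /eqP /eqP.
by rewrite eqseq_rcons eqxx => /eqP.
Qed.

(** Stated for an arbitrary sigma-algebra so as to serve for product
measurability as well as for membership in [sig]. *)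
Lemma reach_sa (G : set (set Om)) n u : sigma_algebra setT G ->
  (forall v k, desc u v -> G [set w | c v w = k]) ->
  (forall v, sdesc u v -> G (o v)) -> G (reach n u).
Proof.
move=> sG; elim: n u => [|n IH] u Hc Ho; first exact: sa_setT sG.
apply: (sa_ex sG) => i; apply: (sa_and sG); last first.
  apply: (sa_and sG).
    by apply/Ho/sdesc_rcons; exact: prefix_refl.
  apply: IH => [v k Hv|v [Hv _]].
    by apply: Hc; exact: desc_rcons Hv.
  by apply: Ho; exact: sdesc_rcons Hv.
have -> : (fun w => (i < c u w)%N : Prop) =
    [set w | exists k, c u w = k /\ (i < k)%N].
  by apply/seteqP; split => w /= => [H|[k [-> H]]] //; exists (c u w).
apply: (sa_ex sG) => k; apply: (sa_and sG); last exact: sa_cst sG _.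
by apply: Hc; exact: prefix_refl.
Qed.

Lemma percolates_sa (G : set (set Om)) u : sigma_algebra setT G ->
  (forall v k, desc u v -> G [set w | c v w = k]) ->
  (forall v, sdesc u v -> G (o v)) -> G (percolates u).
Proof. by move=> sG Hc Ho; apply: (sa_all sG) => n; exact: reach_sa. Qed.

End Reach.

Lemma reach_sub {Om1 Om2 : Type}
  (c1 : seq nat -> Om1 -> nat) (o1 : seq nat -> set Om1)
  (c2 : seq nat -> Om2 -> nat) (o2 : seq nat -> set Om2) w1 w2 n u :
  (forall v, c1 v w1 = c2 v w2) -> (forall v, o1 v w1 -> o2 v w2) ->
  reach c1 o1 n u w1 -> reach c2 o2 n u w2.
Proof.
move=> Hc Ho; elim: n u => [|n IH] u //= [i [iu [oi ri]]].
by exists i; rewrite -Hc; split=> //; split; [exact: Ho | exact: IH].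
Qed.

Section FamilyTree.
Context (c : seq nat -> nat).

Lemma family_tree_rcons u i : family_tree c (rcons u i) ->
  family_tree c u /\ (i < c u)%N.
Proof.
move E : (rcons u i) => v Hv; case: Hv E => [|u' i' Hu' iu'].
  by case: u.
by move=> /eqP; rewrite eqseq_rcons => /andP[/eqP -> /eqP ->].
Qed.

Lemma family_tree_nth u : family_tree c u ->
  forall j, (j < size u)%N -> (nth 0%N u j < c (take j u))%N.
Proof.
elim=> [|{}u i Hu IH iu] j //; rewrite size_rcons ltnS leq_eqVlt.
case/orP=> [/eqP ->|ju].
  by rewrite nth_rcons ltnn eqxx -cats1 take_size_cat.
by rewrite nth_rcons ju -cats1 take_cat ju; exact: IH.
Qed.

Lemma family_tree_reach u : family_tree c u ->
  reach (fun v (_ : unit) => c v) (fun=> setT) (size u) [::] tt.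
Proof.
move=> Hu; have := @reach_path unit (fun v _ => c v) (fun=> setT)
  (fun j => take j u) (size u) 0 tt; rewrite take0; apply=> j.
rewrite add0n => /andP[_ ju]; exists (nth 0%N u j); split=> //.
- exact: take_nth.
- exact: family_tree_nth.
Qed.

Lemma survives_reach : ~ dies_out (family_tree c) ->
  forall n, reach (fun v (_ : unit) => c v) (fun=> setT) n [::] tt.
Proof.
move=> /forallNP H n; have /existsNP [u /not_implyP [Hu /contrapT <-]] := H n.
exact: family_tree_reach.
Qed.

(** A self-avoiding path from the root can never turn back: the first step up
would return to the previous vertex. *)
Lemma infinite_path_child v : infinite_path (family_tree c) v ->
  forall n, exists2 i, v n.+1 = rcons (v n) i & (i < c (v n))%N.
Proof.
case=> v0 vG va vi.
have H n : exists i, v n.+1 = rcons (v n) i.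
  elim: n => [|n [i Hi]].
    by case: (va 0%N) => [|[i]] //; rewrite v0; case: (v 1%N).
  case: (va n.+1) => [//|[j Hj]].
  have /eqP : rcons (v n) i = rcons (v n.+2) j by rewrite -Hi.
  rewrite eqseq_rcons => /andP[/eqP /vi /eqP].
  by rewrite -[X in X == _]addn0 -addn2 eqn_add2l.
move=> n; have [i Hi] := H n; exists i => //.
by have := vG n.+1; rewrite Hi => /family_tree_rcons [].
Qed.

Lemma infinite_path_mk v : v 0%N = [::] ->
  (forall n, exists i, v n.+1 = rcons (v n) i /\ (i < c (v n))%N) ->
  infinite_path (family_tree c) v /\ forall n, size (v n) = n.
Proof.
move=> v0 H.
have sv n : size (v n) = n.
  elim: n => [|n IH]; first by rewrite v0.
  by have [i [-> _]] := H n; rewrite size_rcons IH.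
split=> //; split=> //.
- elim=> [|n IH]; first by rewrite v0; constructor.
  by have [i [-> ii]] := H n; constructor.
- by move=> n; left; have [i [-> _]] := H n; exists i.
- by move=> n n' /(congr1 size); rewrite !sv.
Qed.

End FamilyTree.

(** * The branching recursion *)

Section BranchingProbability.
Context {R : realType} {d : measure_display} {T : measurableType d}
  (P : probability T R) {I : eqType} (C : I -> set (set T)).
Hypothesis HC : indep_systems P C.

Lemma branching_step_le (q : nat -> R) (z : R) (c : T -> nat) (D0 : set I)
    (D : nat -> set I) (Z : nat -> set T) :
  offspring_gf q -> 0 <= z <= 1 ->
  (forall k, sig C D0 [set w | c w = k]) ->
  (forall k, P [set w | c w = k] = (q k)%:E) ->
  (forall i, D0 `&` D i = set0) ->
  (forall i j, i != j -> D i `&` D j = set0) -> (forall i, sig C (D i) (Z i)) ->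
  (forall i, P (Z i) <= z%:E)%E ->
  (P [set w | forall i, (i < c w)%N -> Z i w] <= (gf_eval q z)%:E)%E.
Proof.
move=> hq z01 sc Pc dD0 dD sZ PZ.
rewrite (branching_step HC sc Pc dD0 dD sZ) gf_evalE //.
apply: lee_nneseries => k _.
  by rewrite mule_ge0 ?lee_fin ?hq.1 // prode_ge0.
rewrite EFinM lee_wpmul2l ?lee_fin ?hq.1 //.
elim: k => [|k IH]; first by rewrite big_ord0 expr0.
rewrite big_ord_recr exprSr EFinM /=; apply: lee_pmul => //.
exact: prode_ge0.
Qed.

Lemma branching_step_eq (q : nat -> R) (z : R) (c : T -> nat) (D0 : set I)
    (D : nat -> set I) (Z : nat -> set T) :
  offspring_gf q -> 0 <= z <= 1 ->
  (forall k, sig C D0 [set w | c w = k]) ->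
  (forall k, P [set w | c w = k] = (q k)%:E) ->
  (forall i, D0 `&` D i = set0) ->
  (forall i j, i != j -> D i `&` D j = set0) -> (forall i, sig C (D i) (Z i)) ->
  (forall i, P (Z i) = z%:E)%E ->
  (P [set w | forall i, (i < c w)%N -> Z i w] = (gf_eval q z)%:E)%E.
Proof.
move=> hq z01 sc Pc dD0 dD sZ PZ.
rewrite (branching_step HC sc Pc dD0 dD sZ) gf_evalE //.
apply: eq_eseriesr => k _; rewrite EFinM; congr (_ * _)%E.
elim: k => [|k IH]; first by rewrite big_ord0 expr0.
by rewrite big_ord_recr exprSr EFinM /= IH PZ.
Qed.

Context (c : seq nat -> T -> nat) (o : seq nat -> set T)
  (q : nat -> nat -> R) (r : nat -> R) (Dn Do : seq nat -> set I).
Hypotheses (hq : forall k, offspring_gf (q k.+1)) (hr : forall k, is_prob (r k)).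
Hypotheses (sc : forall u k, sig C (Dn u) [set w | c u w = k])
  (so : forall u, sig C (Do u) (o u)).
Hypotheses (Pc : forall u k, P [set w | c u w = k] = (q (size u).+1 k)%:E)
  (Po : forall u, P (o u) = (r (size u))%:E).
Hypotheses (dnn : forall u v, u != v -> Dn u `&` Dn v = set0)
  (doo : forall u v, u != v -> Do u `&` Do v = set0)
  (dno : forall u v, Dn u `&` Do v = set0).

Let below u : set I :=
  (\bigcup_(v in desc u) Dn v) `|` (\bigcup_(v in sdesc u) Do v).
Let block u : set I := Do u `|` below u.

Let sig_reach n u : sig C (below u) (reach c o n u).
Proof.
apply: reach_sa; first exact: sig_sigma.
- move=> v k uv; apply: (sig_mono _ (@sc v k)) => x Dx; left.
  by exists v.
- move=> v uv; apply: (sig_mono _ (@so v)) => x Dx; right.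
  by exists v.
Qed.

Let disjI (A B : set I) x : A `&` B = set0 -> A x -> B x -> False.
Proof. by move=> AB Ax Bx; suff : (A `&` B) x by rewrite AB. Qed.

Let disj_nn u v x : Dn u x -> Dn v x -> u = v.
Proof.
by move=> ux vx; apply/eqP; apply: contrapT => /negP /dnn /disjI; apply; eassumption.
Qed.

Let disj_oo u v x : Do u x -> Do v x -> u = v.
Proof.
by move=> ux vx; apply/eqP; apply: contrapT => /negP /doo /disjI; apply; eassumption.
Qed.

Let disj_no u v x : Dn u x -> Do v x -> False.
Proof. by move=> ux vx; exact: disjI (dno u v) ux vx. Qed.

Let below_block u i x : block (rcons u i) x ->
  (exists2 v, desc (rcons u i) v & Dn v x) \/
  (exists2 v, desc (rcons u i) v & Do v x).
Proof.
case=> [ox|[[v uv vx]|[v [uv _] vx]]].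
- by right; exists (rcons u i) => //; exact: prefix_refl.
- by left; exists v.
- by right; exists v.
Qed.

(** The complement of [reach n.+1 u] says that for no child [i] of [u] the vertex
is open and reaches depth [n]; these events concern disjoint sets of indices
[block (rcons u i)], none of which meets [Dn u], so [branching_step] applies.
The index sets [Dn] and [Do] of the numbers of children and of the openness are
abstract, so that [Do] may be empty when every vertex is open. *)
Lemma reach_prob n u : P (reach c o n u) =
  (foldr (fun k x => gf_surv (q k) (r k * x)) 1 (iota (size u).+1 n))%:E.
Proof.
elim: n u => [|n IH] u; first by rewrite probability_setT.
set s := foldr _ _ _.
have [s' -> s'01] : exists2 s', s = gf_surv (q (size u).+1) (r (size u).+1 * s') &
    0 <= s' <= 1 /\ forall i, P (reach c o n (rcons u i)) = s'%:E.
  exists (foldr (fun k x => gf_surv (q k) (r k * x)) 1 (iota (size u).+2 n)) => //.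
  split=> [|i]; last by rewrite IH size_rcons.
  elim: n (size u).+2 (isT : (0 < (size u).+2)%N) {IH s} => [|n IH] k k0 /=.
    by rewrite lexx ler01.
  have /andP[x0 x1] := IH k.+1 (ltn0Sn _).
  have /andP[/ltW r0 r1] := hr k.
  by case: k k0 x0 x1 r0 r1 => // k _ *; apply: gf_surv_itv => //;
    rewrite mulr_ge0 // mulr_ile1.
case: s'01 => s'01 Hs'; have /andP[s'0 s'1] := s'01.
have /andP[/ltW r0 r1] := hr (size u).+1.
have rs01 : 0 <= r (size u).+1 * s' <= 1 by rewrite mulr_ge0 // mulr_ile1.
pose Z i : set T := ~` (o (rcons u i) `&` reach c o n (rcons u i)).
have sZ i : sig C (block (rcons u i)) (Z i).
  apply: (sa_setC (sig_sigma _ _)); apply: (sa_and (sig_sigma _ _)).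
    by apply: (sig_mono _ (@so _)) => x Dx; left.
  by apply: (sig_mono _ (@sig_reach n _)) => x Dx; right.
have PZ i : P (Z i) = (1 - r (size u).+1 * s')%:E.
  rewrite probability_setC; last first.
    apply: (sig_measurable HC); apply: (sa_and (sig_sigma _ (block (rcons u i)))).
      by apply: (sig_mono _ (@so _)) => x Dx; left.
    by apply: (sig_mono _ (@sig_reach n _)) => x Dx; right.
  rewrite EFinB; congr (_ - _)%E.
  rewrite EFinM -(Hs' i) -(size_rcons u i) -Po.
  apply: (sig_indep HC _ (@so _) (@sig_reach _ _)).
  apply/seteqP; split=> // x [ox [[v uv vx]|[v [uv vu] vx]]].
    exact: disj_no vx ox.
  by rewrite (disj_oo ox vx) eqxx in vu.
have -> : reach c o n.+1 u = ~` [set w | forall i, (i < c u w)%N -> Z i w].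
  apply/seteqP; split => w /=.
    by move=> [i [iu [oi ri]]] /(_ i iu); apply.
  move=> /existsNP [i /not_implyP [iu /contrapT [oi ri]]].
  by exists i.
have dD0 i : Dn u `&` block (rcons u i) = set0.
  apply/seteqP; split=> // x [ux /below_block [[v uv vx]|[v uv vx]]].
    by have [_] := sdesc_rcons uv; rewrite (disj_nn ux vx) eqxx.
  exact: disj_no ux vx.
have dD i j : i != j -> block (rcons u i) `&` block (rcons u j) = set0.
  move=> ij; apply/seteqP; split=> // x.
  case=> [/below_block [[v uv vx]|[v uv vx]]
    /below_block [[v' uv' vx']|[v' uv' vx']]].
  - rewrite -(disj_nn vx vx') in uv'.
    by rewrite (desc_rcons_inj uv uv') eqxx in ij.
  - exact: disj_no vx vx'.
  - exact: disj_no vx' vx.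
  - rewrite -(disj_oo vx vx') in uv'.
    by rewrite (desc_rcons_inj uv uv') eqxx in ij.
have z01 : 0 <= 1 - r (size u).+1 * s' <= 1 by lra.
have E := branching_step_eq (hq (size u)) z01 (@sc u) (Pc u) dD0 dD sZ PZ.
rewrite probability_setC; first by rewrite E -EFinB.
have -> : [set w | forall i, (i < c u w)%N -> Z i w] = ~` (reach c o n.+1 u).
  apply/seteqP; split => w /=; last first.
    by move=> /forallNP H i iu [oi ri]; apply: (H i).
  by move=> H [i [iu [oi ri]]]; apply: (H i iu).
apply/measurableC/(sig_measurable HC (@sig_reach n.+1 u)).
Qed.

End BranchingProbability.

(** * Independence on the product space *)

Section Systems.
Context {R : realType}.

Lemma indep_family_systems {d d' : measure_display} {T : measurableType d}
    {T' : measurableType d'} (P : probability T R) (I : eqType)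
    (X : I -> {RV P >-> T'}) : independent_family X ->
  indep_systems P (fun i => [set X i @^-1` A | A in measurable]).
Proof.
move=> iX; split.
- by move=> i; exists setT.
- move=> i _ _ [A mA <-] [B mB <-]; exists (A `&` B); first exact: measurableI.
  by rewrite preimage_setI.
- move=> i _ [A mA <-]; rewrite -[X in measurable X]setTI.
  exact: measurable_funPT.
- move=> s E us HE.
  have /choice [A HA] : forall i, exists A, measurable A /\ E i = X i @^-1` A.
    by move=> i; have [A mA <-] := HE i; exists A.
  have -> : E = fun i => X i @^-1` A i by apply/funext => i; case: (HA i).
  by apply: iX => // i; case: (HA i).
Qed.

Section Product.
Context {d1 d2 : measure_display} {T1 : measurableType d1}
  {T2 : measurableType d2} (P1 : probability T1 R) (P2 : probability T2 R)
  {I1 I2 : eqType} (C1 : I1 -> set (set T1)) (C2 : I2 -> set (set T2)).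

Definition prod_systems (i : I1 + I2) : set (set (T1 * T2)) :=
  match i with
  | inl i => [set A `*` setT | A in C1 i]
  | inr j => [set setT `*` B | B in C2 j]
  end.

Lemma indep_systems_prod : indep_systems P1 C1 -> indep_systems P2 C2 ->
  indep_systems (P1 \x P2)%E prod_systems.
Proof.
move=> H1 H2; pose PP : probability (T1 * T2)%type R := (P1 \x P2)%E.
have PPE A B : measurable A -> measurable B -> PP (A `*` B) = (P1 A * P2 B)%E.
  exact: product_measure1E.
change (indep_systems PP prod_systems); split.
- case=> i; exists setT; rewrite ?setXTT //; [exact: sysT H1 _ | exact: sysT H2 _].
- case=> i _ _ [A CA <-] [B CB <-]; exists (A `&` B); rewrite -?setXI ?setTI //.
  + exact: (sysI H1).
  + exact: (sysI H2).
- case=> i _ [A CA <-]; apply: measurableX => //.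
  + exact: (sysM H1) CA.
  + exact: (sysM H2) CA.
move=> s E us HE.
have /choice [A HA] : forall i, exists A, C1 i A /\ E (inl i) = A `*` setT.
  by move=> i; have [A CA <-] := HE (inl i); exists A.
have /choice [B HB] : forall j, exists B, C2 j B /\ E (inr j) = setT `*` B.
  by move=> j; have [B CB <-] := HE (inr j); exists B.
pose l (x : I1 + I2) := if x is inl i then Some i else None.
pose r (x : I1 + I2) := if x is inr i then Some i else None.
have ul : uniq (pmap l s) by apply: (@pmap_uniq _ _ l inl) => // -[].
have ur : uniq (pmap r s) by apply: (@pmap_uniq _ _ r inr) => // -[].
have ml i : (i \in pmap l s) = (inl i \in s).
  rewrite mem_pmap; apply/mapP/idP => [[[j|j] js] //= [->] //|is_].
  by exists (inl i).
have mr i : (i \in pmap r s) = (inr i \in s).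
  rewrite mem_pmap; apply/mapP/idP => [[[j|j] js] //= [->] //|is_].
  by exists (inr i).
have capE : \bigcap_(i in [set` s]) E i =
    (\bigcap_(i in [set` pmap l s]) A i) `*` (\bigcap_(i in [set` pmap r s]) B i).
  apply/seteqP; split => [[x y] H|[x y] [/= Hx Hy] [i|j] /= si].
  - split=> i /=; rewrite ?ml ?mr => si.
      by have := H _ si; rewrite (HA i).2 => -[].
    by have := H _ si; rewrite (HB i).2 => -[].
  - by rewrite (HA i).2; split=> //=; apply: Hx; rewrite /= ml.
  - by rewrite (HB j).2; split=> //=; apply: Hy; rewrite /= mr.
have mA i : measurable (A i) by apply: (sysM H1 (HA i).1).
have mB i : measurable (B i) by apply: (sysM H2 (HB i).1).
rewrite capE.
rewrite PPE; [|exact: fin_bigcap_measurable..].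
rewrite (sysP H1 ul (fun i => (HA i).1)) (sysP H2 ur (fun i => (HB i).1)).
elim: s {us ul ur ml mr capE} => [|[i|j] s IH]; rewrite /= ?big_nil ?mule1 //.
- rewrite !big_cons -IH (HA i).2 PPE //.
  by rewrite probability_setT mule1 muleA.
- rewrite !big_cons -IH (HB j).2 PPE //.
  by rewrite probability_setT mul1e muleCA.
Qed.

End Product.

Lemma uniform_le (p : R) : 0 <= p <= 1 ->
  uniform_prob (@ltr01 R) [set x | x <= p] = p%:E.
Proof.
case/andP=> p0 p1; rewrite /uniform_prob integral_uniform_pdf.
have -> : [set x | x <= p] `&` `[(0 : R), 1]%classic = `[0, p]%classic.
  apply/seteqP; split => x /=; rewrite !in_itv /=.
    by case=> -> /andP[->].
  by case/andP=> -> xp; rewrite xp (le_trans xp).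
rewrite (eq_integral (fun=> (1 : R)%:E)); last first.
  move=> x; rewrite inE /= in_itv /= => /andP[x0 xp].
  by rewrite /uniform_pdf x0 (le_trans xp) //= subr0 invr1.
rewrite integral_cst //= lebesgue_measure_itv /= lte_fin mul1e.
by case: ltgtP p0 => [p0|//|<-] _; rewrite ?sube0 ?oppr0 ?adde0.
Qed.

End Systems.

(** * Percolation on a random tree *)

Section Percolation.
Context {R : realType} {dX : measure_display} {TX : measurableType dX}
  (PX : probability TX R) (X : seq nat -> {RV PX >-> R}) (p : nat -> R).
Hypotheses (iX : iid_uniform01 X) (hp : forall i, is_prob (p i)).

Definition open_vertex (v : seq nat) : set TX := [set x | X v x <= p (size v)].

Definition level_set : set (nat -> R) := [set x | forall n, x n <= p n.+1].

Lemma open_vertexE v :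
  open_vertex v = X v @^-1` [set x | x <= p (size v)].
Proof. by []. Qed.

Lemma measurable_le_set (a : R) : measurable [set x : R | x <= a].
Proof.
have -> : [set x : R | x <= a] = `]-oo, a]%classic.
  by apply/seteqP; split => x /=; rewrite in_itv.
exact: measurable_itv.
Qed.

Lemma measurable_open_vertex v : measurable (open_vertex v).
Proof.
rewrite open_vertexE -[X in measurable X]setTI; apply: measurable_funPT => //.
exact: measurable_le_set.
Qed.

Lemma open_vertex_prob v : PX (open_vertex v) = (p (size v))%:E.
Proof.
have /andP[p0 p1] := hp (size v).
rewrite -uniform_le; last by rewrite ltW.
by rewrite -(iX.2 v) //; exact: measurable_le_set.
Qed.

Section Tree.
Context {d : measure_display} {T : measurableType d} (P : probability T R)
  (q : nat -> R) (N : seq nat -> {RV P >-> nat}).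
Hypotheses (hq : offspring_gf q) (hN : galton_watson q N).

Definition joint_children (v : seq nat) (z : T * TX) : nat := N v z.1.
Definition joint_open (v : seq nat) : set (T * TX) := [set z | open_vertex v z.2].

Definition joint_reach := reach joint_children joint_open.
Definition joint_percolates := percolates joint_children joint_open.

Lemma measurable_children (D : set nat) v : measurable (N v @^-1` D).
Proof. by rewrite -[X in measurable X]setTI; exact: measurable_funPT. Qed.

Lemma joint_reach_prob n u : (P \x PX)%E (joint_reach n u) =
  (surv (gf_surv q) (word p (size u) n))%:E.
Proof.
have HN := indep_family_systems hN.1; have HX := indep_family_systems iX.1.
have HP := indep_systems_prod HN HX.
rewrite /surv /word foldr_map.
pose PP : probability (T * TX)%type R := (P \x PX)%E.
have PPE A B : measurable A -> measurable B -> PP (A `*` B) = (P A * PX B)%E.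
  exact: product_measure1E.
have ne (A : Type) (i j : A) : i <> j -> [set i] `&` [set j] = set0.
  by move=> ij; apply/seteqP; split=> // x [/= -> /ij].
apply: (@reach_prob R _ _ PP _ _ HP joint_children joint_open (fun=> q) p
  (fun u => [set inl u]) (fun u => [set inr u])) => //.
- move=> v k; apply: (sig_in HP erefl); exists (N v @^-1` [set k]).
    by exists [set k].
  by apply/seteqP; split=> -[x y] //= [].
- move=> v; apply: (sig_in HP erefl); exists (open_vertex v).
    by exists [set x | x <= p (size v)] => //; exact: measurable_le_set.
  by apply/seteqP; split=> -[x y] //= [].
- move=> v k; have -> : [set w | joint_children v w = k] =
      (N v @^-1` [set k]) `*` setT.
    by apply/seteqP; split=> -[x y] //= [].
  rewrite PPE ?probability_setT ?mule1 ?hN.2 //; exact: measurable_children.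
- move=> v; have -> : joint_open v = setT `*` open_vertex v.
    by apply/seteqP; split=> -[x y] //= [].
  rewrite PPE ?probability_setT ?mul1e ?open_vertex_prob //.
  exact: measurable_open_vertex.
- by move=> v v' vv; apply: ne => -[] /eqP; apply/negP.
- by move=> v v' vv; apply: ne => -[] /eqP; apply/negP.
- by move=> v v'; apply: ne.
Qed.

Lemma measurable_joint_reach n u : measurable (joint_reach n u).
Proof.
apply: reach_sa; first exact: sigma_algebra_measurable.
- move=> v k _; have -> : [set w | joint_children v w = k] =
      (N v @^-1` [set k]) `*` setT.
    by apply/seteqP; split=> -[x y] //= [].
  by apply: measurableX => //; exact: measurable_children.
- move=> v _; have -> : joint_open v = setT `*` open_vertex v.
    by apply/seteqP; split=> -[x y] //= [].
  by apply: measurableX => //; exact: measurable_open_vertex.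
Qed.

Lemma measurable_joint_percolates u : measurable (joint_percolates u).
Proof.
apply: (sa_all (@sigma_algebra_measurable _ _)) => n.
exact: measurable_joint_reach.
Qed.

(** Probability, given the tree, that an infinite open path descends from
[u]. *)
Definition quenched u (w : T) : \bar R := PX (xsection (joint_percolates u) w).

Lemma measurable_quenched u : measurable_fun [set: T] (quenched u : T -> \bar R).
Proof.
exact: (measurable_fun_xsection PX (measurable_joint_percolates u)).
Qed.

Lemma quenched_ge0 u w : (0 <= quenched u w)%E.
Proof. exact: measure_ge0. Qed.

Lemma joint_percolatesE u : (P \x PX)%E (joint_percolates u) =
  (\int[P]_w quenched u w)%E.
Proof. by []. Qed.

Lemma polar_of_quenched w : quenched [::] w = 0%E ->
  polar X (family_tree (fun u => N u w)) level_set.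
Proof.
move=> q0; apply: (@negligibleS _ _ _ _ (xsection (joint_percolates [::]) w)).
  move=> x [v [Hv Bv]]; apply/xsectionP => n.
  have Hc := infinite_path_child Hv.
  have [v0 _ _ _] := Hv.
  have sv k : size (v k) = k.
    elim: k => [|k IH]; first by rewrite v0.
    by have [i -> _] := Hc k; rewrite size_rcons IH.
  rewrite -v0; apply: reach_path => j _.
  have [i vi ii] := Hc j; exists i; split=> //.
  by rewrite /joint_open /= /open_vertex /= sv; exact: Bv.
apply/negligibleP => //; apply: measurable_xsection.
exact: measurable_joint_percolates.
Qed.

Lemma quenched_of_polar w :
  polar X (family_tree (fun u => N u w)) level_set -> quenched [::] w = 0%E.
Proof.
move=> pol; apply: measure_negligible.
  by apply: measurable_xsection; exact: measurable_joint_percolates.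
apply: negligibleS pol => x /xsectionP /= Hp.
have [v [v0 Hv]] := percolates_path Hp.
have [|iv sv] := @infinite_path_mk (fun u => N u w) v v0.
  by move=> n; have [i [? ? _]] := Hv n; exists i.
exists v; split=> // n; have [i [_ _]] := Hv n.
by rewrite /joint_open /= /open_vertex /= sv.
Qed.

Lemma ae_polar : (P \x PX)%E (joint_percolates [::]) = 0%E ->
  {ae P, forall w, polar X (family_tree (fun u => N u w)) level_set}.
Proof.
rewrite joint_percolatesE => i0.
have := (ae_eq_integral_abs P measurableT (measurable_quenched [::])).1.
under eq_integral do rewrite gee0_abs ?quenched_ge0 //.
move=> /(_ i0); apply: filterS => w /(_ I) H.
exact: polar_of_quenched.
Qed.

End Tree.
End Percolation.

(** * Nullity and extinction *)

Lemma reach_total_prob {R : realType} {d : measure_display} {T : measurableType d}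
    (P : probability T R) (q : nat -> nat -> R) (N : seq nat -> {RV P >-> nat}) n u :
  (forall k, offspring_gf (q k.+1)) -> branching_process q N ->
  P (reach (fun v => N v) (fun=> setT) n u) =
  (foldr (fun k => gf_surv (q k)) 1 (iota (size u).+1 n))%:E.
Proof.
move=> hq hN; have HC := indep_family_systems hN.1.
rewrite (_ : foldr _ _ _ =
    foldr (fun k x => gf_surv (q k) (1 * x)) 1 (iota (size u).+1 n)); last first.
  by elim: n (size u).+1 => [|n IH] k //=; rewrite IH mul1r.
apply: (@reach_prob R _ _ P _ _ HC (fun v => N v) (fun=> setT) q (fun=> 1)
  (fun u => [set u]) (fun=> set0)) => //.
- by move=> k; rewrite /is_prob ltr01 lexx.
- by move=> v k; apply: (sig_in HC erefl); exists [set k].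
- by move=> v; exact: sa_setT (sig_sigma _ _).
- by move=> v k; exact: hN.2.
- by move=> v; exact: probability_setT.
- by move=> v v' vv; apply/seteqP; split=> // x [/= ->] /eqP; apply/negP.
- by move=> v v' vv; rewrite setI0.
- by move=> v v'; rewrite setI0.
Qed.

Lemma measurable_reach_total {R : realType} {d : measure_display}
    {T : measurableType d} (P : probability T R) (N : seq nat -> {RV P >-> nat}) n u :
  measurable (reach (fun v => N v) (fun=> setT) n u).
Proof.
apply: reach_sa; first exact: sigma_algebra_measurable.
  by move=> v k _; exact: (measurable_children N [set k] v).
by move=> v _; exact: measurableT.
Qed.

Lemma survives_reach_total {T : Type} (N : seq nat -> T -> nat) w :
  ~ dies_out (family_tree (fun u => N u w)) ->
  forall n, reach N (fun=> setT) n [::] w.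
Proof.
by move=> H n; apply: reach_sub (survives_reach H n) => // v.
Qed.

Section Nonpolar.
Context {R : realType} {dX : measure_display} {TX : measurableType dX}
  (PX : probability TX R) (X : seq nat -> {RV PX >-> R}) (p : nat -> R).
Hypotheses (iX : iid_uniform01 X) (hp : forall i, is_prob (p i)).
Context {d : measure_display} {T : measurableType d} (P : probability T R)
  (q : nat -> R) (N : seq nat -> {RV P >-> nat}).
Hypotheses (hq : offspring_gf q) (hN : galton_watson q N).

Let CN := fun i => [set N i @^-1` A | A in measurable].
Let CX := fun i => [set X i @^-1` A | A in measurable].
Let HN : indep_systems P CN. Proof. exact: indep_family_systems hN.1. Qed.
Let HX : indep_systems PX CX. Proof. exact: indep_family_systems iX.1. Qed.

(** Trees in which almost surely no infinite open path descends from [u]. *)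
Definition null_set u := [set w | quenched X p N u w = 0%E].

(** Measurability of sections, with the space of trees carrying only the
sigma-algebra of the numbers of children of the descendants of [u]. *)
Lemma sig_null_set u : sig CN (desc u) (null_set u).
Proof.
pose TT := g_sigma_algebraType (cyl CN (desc u)).
have mA : measurable (joint_percolates X p N u : set (TT * TX)).
  apply: (@percolates_sa (TT * TX)%type).
  - exact: sigma_algebra_measurable.
  - move=> v k uv.
    have -> : [set w : TT * TX | joint_children N v w = k] =
        (N v @^-1` [set k] : set TT) `*` setT.
      by apply/seteqP; split=> -[x y] //= [].
    apply: measurableX => //; apply: (sig_in HN uv).
    by exists [set k].
  - move=> v _; have -> : joint_open X p v = [set: T] `*` open_vertex X p v.
      by apply/seteqP; split=> -[x y] //= [].
    by apply: (@measurableX _ _ TT TX) => //; exact: measurable_open_vertex.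
have := measurable_fun_xsection PX mA.
move=> /(_ measurableT [set 0%E] (emeasurable_set1 _)).
by rewrite setTI.
Qed.

Lemma measurable_null_set u : measurable (null_set u).
Proof. exact: (sig_measurable HN (@sig_null_set u)). Qed.

Lemma xsection_percolates u w : xsection (joint_percolates X p N u) w =
  percolates (fun v (_ : TX) => N v w) (open_vertex X p) u.
Proof.
apply/seteqP; split => x.
  by move=> /xsectionP H n; apply: reach_sub (H n).
by move=> H; apply/xsectionP => n; apply: reach_sub (H n).
Qed.

(** The openness of a child is independent of the paths below it and has positive
probability. *)
Lemma null_set_child u w : null_set u w ->
  forall i, (i < N u w)%N -> null_set (rcons u i) w.
Proof.
rewrite /null_set /= /quenched !xsection_percolates => H i iu.
rewrite xsection_percolates; set A := percolates _ _ (rcons u i).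
have sA : sig CX (sdesc (rcons u i)) A.
  apply: percolates_sa; first exact: sig_sigma.
    by move=> v k _; apply: sa_cst; exact: sig_sigma.
  move=> v uv; apply: (sig_in HX uv).
  by exists [set x | x <= p (size v)] => //; exact: measurable_le_set.
have so : sig CX [set rcons u i] (open_vertex X p (rcons u i)).
  apply: (sig_in HX erefl).
  by exists [set x | x <= p (size (rcons u i))] => //; exact: measurable_le_set.
have dis : [set rcons u i] `&` sdesc (rcons u i) = set0.
  by apply/seteqP; split=> // v [/= ->] []; rewrite eqxx.
have := sig_indep HX dis so sA; rewrite open_vertex_prob // => E.
have : (PX (open_vertex X p (rcons u i) `&` A) <= 0)%E.
  rewrite -H; apply: le_measure; rewrite ?inE.
  - apply: measurableI; first exact: (sig_measurable HX so).
    exact: (sig_measurable HX sA).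
  - rewrite -xsection_percolates; apply: measurable_xsection.
    exact: measurable_joint_percolates.
  - by move=> x [ox Ax] [|n] //=; exists i; split.
rewrite E => le0; have /andP[p0 _] := hp (size (rcons u i)).
have /eqP : ((p (size (rcons u i)))%:E * PX A = 0)%E.
  by apply/eqP; rewrite eq_le le0 mule_ge0 // lee_fin ltW.
by rewrite mule_eq0 eqe gt_eqF //= => /eqP.
Qed.

Lemma null_set_iter n s0 : 0 <= s0 <= 1 ->
  (forall v, size v = n -> P (null_set v) <= (1 - s0)%:E)%E ->
  forall k u, (size u + k)%N = n ->
    (P (null_set u) <= (1 - iter k (gf_surv q) s0)%:E)%E.
Proof.
move=> s01 H; elim=> [|k IH] u su; first by apply: H; rewrite -su addn0.
have i01 : 0 <= iter k (gf_surv q) s0 <= 1.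
  by elim: k {IH su} => [|k IH] //=; exact: gf_surv_itv.
apply: (@le_trans _ _ (P [set w | forall i, (i < N u w)%N ->
    null_set (rcons u i) w])).
  apply: le_measure; rewrite ?inE.
  - exact: measurable_null_set.
  - apply: (sa_all (@sigma_algebra_measurable _ _)) => i.
    apply: (sa_imply (@sigma_algebra_measurable _ _)).
      by apply: (measurable_children N [set k | (i < k)%N]).
    exact: measurable_null_set.
  - by move=> w; exact: null_set_child.
have z01 : 0 <= 1 - iter k (gf_surv q) s0 <= 1 by lra.
rewrite /= /gf_surv opprB addrCA subrr addr0.
apply: (branching_step_le HN (D0 := [set u]) (D := fun i => desc (rcons u i))
  hq z01) => //.
- by move=> j; apply: (sig_in HN erefl); exists [set j].
- by move=> j; exact: hN.2.
- move=> i; apply/seteqP; split=> // v [/= ->] /sdesc_rcons [].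
  by rewrite eqxx.
- move=> i j ij; apply/seteqP; split=> // v [vi vj].
  by rewrite (desc_rcons_inj vi vj) eqxx in ij.
- by move=> i; exact: sig_null_set.
- by move=> i; apply: IH; rewrite size_rcons addSn -addnS.
Qed.

(** The joint probability that an open path descends from [u] is the integral of
[quenched u], a function that is at most 1 and vanishes on [null_set u]. *)
Lemma null_set_level u s0 :
  (forall n, s0 <= surv (gf_surv q) (word p (size u) n)) ->
  (P (null_set u) <= (1 - s0)%:E)%E.
Proof.
move=> Hs; pose PP : probability (T * TX)%type R := (P \x PX)%E.
have PPs : (s0%:E <= PP (joint_percolates X p N u))%E.
  have E : joint_percolates X p N u = \bigcap_n joint_reach X p N n u.
    by apply/seteqP; split => z H n; [move=> _; exact: H | exact: (H n I)].
  have mr n : measurable (joint_reach X p N n u) by exact: measurable_joint_reach.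
  have cv : PP (joint_reach X p N n u) @[n --> \oo] -->
      PP (joint_percolates X p N u).
    rewrite E; apply: nonincreasing_cvg_mu => //.
    - by rewrite ltey_eq fin_num_measure.
    - exact: bigcapT_measurable.
    - by move=> n n' nn; apply/subsetPset; exact: reach_antiW.
  rewrite -(cvg_lim _ cv) //; apply: lime_ge.
    by apply/cvg_ex; eexists; exact: cv.
  apply: nearW => n.
  have -> : PP (joint_reach X p N n u) =
    (surv (gf_surv q) (word p (size u) n))%:E by exact: joint_reach_prob.
  by rewrite lee_fin.
have PPint : (PP (joint_percolates X p N u) <= P (~` null_set u))%E.
  have mN := measurable_null_set u.
  have mNC : measurable (~` null_set u) by exact: measurableC.
  have -> : PP (joint_percolates X p N u) = (\int[P]_w quenched X p N u w)%E by [].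
  rewrite -[leRHS]mul1e -[leRHS](@integral_cst _ _ _ P _ mNC 1%E).
  rewrite [leRHS]integral_mkcond; apply: ge0_le_integral => //.
  - exact: measurable_quenched.
  - by apply/(measurable_restrictT _ mNC); exact: measurable_cst.
  - move=> w _; rewrite patchE; case: ifPn => [_|].
      apply: probability_le1; apply: measurable_xsection.
      exact: measurable_joint_percolates.
    by rewrite notin_setE /= => /contrapT ->.
move: (le_trans PPs PPint).
rewrite probability_setC; last exact: measurable_null_set.
have /fineK <- : P (null_set u) \is a fin_num.
  by rewrite fin_num_measure //; exact: measurable_null_set.
by rewrite -EFinB !lee_fin; lra.
Qed.

(** Emptiness of a given generation implies nullity of the root, and for a suitable
generation the probabilities of the two events are arbitrarily close. *)
Lemma ae_nonpolar (K : nat -> nat) (s0 : R) : 0 <= s0 <= 1 ->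
  (forall j, (j <= K j)%N) ->
  (forall j n, s0 <= surv (gf_surv q) (word p (K j) n)) ->
  (forall e, 0 < e -> exists n0, forall n, (n0 <= n)%N ->
    iter n (gf_surv q) 1 - iter n (gf_surv q) s0 <= e) ->
  {ae P, forall w, ~ dies_out (family_tree (fun u => N u w)) ->
    nonpolar X (family_tree (fun u => N u w)) (level_set p)}.
Proof.
move=> s01 hK hs hgap.
pose E n := reach (fun v => N v) (fun=> setT) n [::].
have mE n : measurable (E n) by exact: measurable_reach_total.
have mN := measurable_null_set [::].
pose A := null_set [::] `&` [set w | forall n, E n w].
have mA : measurable A.
  by apply: measurableI => //; apply: (sa_all (@sigma_algebra_measurable _ _)).
have PE n : P (E n) = (iter n (gf_surv q) 1)%:E.
  rewrite (reach_total_prob n [::] (fun=> hq) hN); congr EFin.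
  by elim: n (size [::]).+1 => [|n IH] k //=; rewrite IH.
have EN n : ~` E n `<=` null_set [::].
  move=> w En; rewrite /null_set /= /quenched.
  have -> : xsection (joint_percolates X p N [::]) w = set0; last exact: measure0.
  apply/seteqP; split=> // x /xsectionP H; apply: En.
  by apply: reach_sub (H n).
have PA : P A = 0%E.
  apply/eqP; rewrite eq_le measure_ge0 andbT; apply/lee_addgt0Pr => e e0.
  rewrite add0e; have [n0 Hn0] := hgap e e0.
  pose n := K n0; have nn0 : (n0 <= n)%N := hK n0.
  have Pn : (P (null_set [::]) <= (1 - iter n (gf_surv q) s0)%:E)%E.
    apply: (null_set_iter s01 (n := n)) => // v sv.
    by apply: null_set_level => k; rewrite sv; exact: hs.
  apply: (@le_trans _ _ (P (null_set [::] `\` ~` E n))).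
    apply: le_measure; rewrite ?inE //.
      by apply: measurableD => //; exact: measurableC.
    by move=> w [Nw Ew]; split=> //; apply.
  have -> : (P (null_set [::] `\` ~` E n) = P (null_set [::]) - P (~` E n))%E.
    rewrite measureD //; [|exact: measurableC|by rewrite ltey_eq fin_num_measure].
    by rewrite (setIidr (EN n)).
  rewrite probability_setC // PE.
  apply: (le_trans (leeB Pn (lexx _))).
  by rewrite -!EFinB lee_fin; have := Hn0 n nn0; lra.
exists A; split=> // w /= /not_implyP [sur npol]; split.
  have /contrapT pol := npol.
  by rewrite /null_set /= quenched_of_polar.
exact: survives_reach_total.
Qed.

End Nonpolar.

(** * Conclusion *)

Section Conclusion.
Context {R : realType}.

Lemma le_half_expr_eq0 (x : \bar R) : (0 <= x)%E ->
  (forall j, (x <= (2 * 2^-1 ^+ j)%:E)%E) -> x = 0%E.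
Proof.
move=> x0 H; apply/eqP; rewrite eq_le x0 andbT; apply/lee_addgt0Pr => e e0.
have h0 : 0 <= (2^-1 : R) by [].
have h1 : (2^-1 : R) < 1 by rewrite invf_lt1 // ltr1n.
have e2 : 0 < e / 2 by rewrite divr_gt0.
have [n0 /(_ n0 (leqnn _)) Hn] := expr_small h0 h1 e2.
rewrite add0e; apply: le_trans (H n0) _; rewrite lee_fin.
by rewrite mulrC -ler_pdivlMr.
Qed.

Lemma word_catD (p : nat -> R) k n r :
  word p k (n + r) = word p k n ++ word p (k + n) r.
Proof. by rewrite /word iotaD map_cat addSn. Qed.

Lemma thinned_surv (g p : nat -> R) k n : offspring_gf g ->
  (forall i, is_prob (p i)) ->
  foldr (fun k => gf_surv (thin g (p k))) 1 (iota k.+1 n) =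
  surv (gf_surv g) (word p k n).
Proof.
move=> hg hp; elim: n k => [|n IH] k //=; rewrite IH.
transitivity (gf_surv g (p k.+1 * surv (gf_surv g) (word p k.+1 n))); last by [].
have /andP[s0 s1] := surv_itv hg (word_prob k.+1 n hp).
have /andP[p0 p1] := hp k.+1.
rewrite /gf_surv gf_eval_thin //; [|by rewrite ltW|lra].
by congr (_ - gf_eval g _); rewrite /word; ring.
Qed.

(** Between two starting points of words, [surv_inv] bounds [surv] from below by
a constant; any other length is shorter than some such stretch, and [surv] decreases
with the length. *)
Lemma surv_level (f : nat -> R) (m C S : R) (p : nat -> R) (K : nat -> nat) :
  offspring_gf f -> gf_deriv1 f = m%:E -> 1 < m -> gf_deriv2 f = C%:E ->
  0 <= C -> (forall i, is_prob (p i)) -> (forall j, (j <= K j)%N) ->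
  (forall i j, (i <= j)%N -> wsum m (word p (K i) (K j - K i)) <= S) ->
  exists2 s0, 0 < s0 <= 1 &
    forall j n, s0 <= surv (gf_surv f) (word p (K j) n).
Proof.
move=> hf hm m1 hC C0 hp hK hS; have m0 : 0 < m by apply: lt_trans m1.
have S0 : 0 <= S by have := hS 0%N 0%N isT; rewrite subnn.
pose c := (C + m) / m ^+ 2.
have c0 : 0 <= c by rewrite divr_ge0 ?exprn_ge0 ?addr_ge0 // ltW.
have D0 : 0 < (1 + c) * (1 + S) by rewrite mulr_gt0 // ltr_wpDr.
have D1 : 1 <= (1 + c) * (1 + S) by rewrite mulr_ege1 // lerDl.
exists ((1 + c) * (1 + S))^-1; first by rewrite invr_gt0 D0 invf_le1.
move=> j n.
have jK : (K j + n <= K (K j + n))%N := hK _.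
have jj : (j <= K j + n)%N by apply: leq_trans (hK j) (leq_addr _ _).
have := hS _ _ jj; set n' := (K (K j + n) - K j)%N => hw.
have nn : (n <= n')%N by rewrite leq_subRL // (leq_trans _ jK) // leq_addr.
have [s0 sle] := surv_inv hf hm m1 hC C0 (word_prob (K j) n' hp).
apply: (@le_trans _ _ (surv (gf_surv f) (word p (K j) n'))).
  rewrite -[leRHS]invrK lef_pV2 ?posrE ?invr_gt0 //; apply: le_trans sle _.
  by rewrite ler_wpM2l ?addr_ge0 // lerD2l.
rewrite -(subnKC nn) word_catD.
by apply: surv_cat_anti => //; exact: word_prob.
Qed.

End Conclusion.

Theorem mainTheorem2 (R : realType) (f g : nat -> R) (m : R)
  (hf : offspring_gf f) (hg : offspring_gf g)
  (hfm : gf_deriv1 f = m%:E) (hgm : gf_deriv1 g = m%:E) (hm : 1 < m)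
  (hf2 : (gf_deriv2 f < +oo)%E) (hg2 : gf_deriv2 g = +oo%E) :
  exists p : nat -> R,
    (forall n, (1 <= n)%N -> 0 < p n <= 1) /\
    (* (i) *)
    (\sum_(1 <= n <oo) (\prod_(1 <= k < n.+1) (m * p k)^-1)%:E < +oo)%E /\
    (* (ii) *)
    (exists gn : nat -> nat -> R,
      (forall n, (1 <= n)%N ->
        offspring_gf (gn n) /\
        forall z, 0 <= z <= 1 ->
          gf_eval (gn n) z = gf_eval g (1 - p n + p n * z)) /\
      forall (d : measure_display) (T : measurableType d)
        (P : probability T R) (N : seq nat -> {RV P >-> nat}),
        branching_process gn N ->
        {ae P, forall w, dies_out (family_tree (fun u => N u w))}) /\
    let B : set (nat -> R) := [set x | forall n, x n <= p n.+1] in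
    forall (dX : measure_display) (TX : measurableType dX)
      (PX : probability TX R) (X : seq nat -> {RV PX >-> R}),
      iid_uniform01 X ->
      (forall (d : measure_display) (T : measurableType d)
        (P : probability T R) (N : seq nat -> {RV P >-> nat}),
        galton_watson g N ->
        {ae P, forall w, polar X (family_tree (fun u => N u w)) B}) /\
      (forall (d : measure_display) (T : measurableType d)
        (P : probability T R) (N : seq nat -> {RV P >-> nat}),
        galton_watson f N ->
        {ae P, forall w, ~ dies_out (family_tree (fun u => N u w)) ->
          nonpolar X (family_tree (fun u => N u w)) B}).
Proof.
have [p [K [S [hp K0 hK hsurv hS]]]] := exists_thinning hg hgm hm hg2.
have m0 : 0 < m by apply: lt_trans hm.
have p01 i : 0 <= p i <= 1 by have /andP[/ltW -> ->] := hp i.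
exists p; split; first by move=> n _; exact: hp.
split.
  apply: (thinning_sum (S := S) m0 hp hK) => j.
  by have := hS 0%N j (leq0n _); rewrite K0 subn0.
split.
  exists (fun n => thin g (p n)); split.
    move=> n _; split; first exact: offspring_thin.
    by move=> z; exact: gf_eval_thin.
  move=> d T P N hN.
  pose E n := reach (fun v => N v) (fun=> setT) n [::].
  have mA : measurable [set w | forall n, E n w].
    apply: (sa_all (@sigma_algebra_measurable _ _)) => n.
    exact: measurable_reach_total.
  exists [set w | forall n, E n w]; split=> //; last first.
    by move=> w /= Nd; exact: survives_reach_total.
  apply: le_half_expr_eq0 => // j.
  apply: (@le_trans _ _ (P (E (K j)))).
    apply: le_measure; rewrite ?inE //; exact: measurable_reach_total.
  rewrite (@reach_total_prob _ _ _ _ (fun n => thin g (p n))) //; last first.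
    by move=> k; exact: offspring_thin.
  by rewrite thinned_surv // lee_fin.
move=> B dX TX PX X iX; split=> d T P N hN.
  apply: ae_polar => //. 
  apply: le_half_expr_eq0 => [|j].
    exact: measure_ge0.
  apply: (@le_trans _ _ ((P \x PX)%E (joint_reach X p N (K j) [::]))).
    apply: le_measure; rewrite ?inE.
    + exact: measurable_joint_percolates.
    + exact: measurable_joint_reach.
    + by move=> w; exact.
  by rewrite (joint_reach_prob iX hp hg hN) lee_fin.
have f20 : (0 <= gf_deriv2 f)%E.
  by apply: nneseries_ge0 => k _ _; rewrite lee_fin mulr_ge0 // hf.1.
have f2E : gf_deriv2 f = (fine (gf_deriv2 f))%:E.
  by rewrite fineK // ge0_fin_numE.
have C0 : 0 <= fine (gf_deriv2 f) by exact: fine_ge0.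
have [s0 s01 hs] := surv_level hf hfm hm f2E C0 hp hK hS.
apply: (ae_nonpolar iX hp hf hN (K := K) (s0 := s0)) => //.
  by case/andP: s01 => /ltW -> ->.
exact: (iter_surv_close hf hfm hm f2E C0 s01).
Qed.
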